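(* Let $n\in\mathbb N$, let $A,B,\lambda$ be fixed real numbers with $\lambda>0$, let $a_k=\alpha_k+\mathrm i\beta_k$ ($k=1,2,\dots$) with $\alpha_k\in\mathbb R$, $\beta_k>0$, let $\rho_0\neq 0$ be an arbitrary constant and $\rho_n(z)=\rho_0\prod_{k=1}^n(z-a_k)$. Let $P_{n-1}$ be the set of polynomials with complex coefficients of degree at most $n-1$, and for $p\in P_{n-1}$ put $$\mathcal F_n(p,\lambda)=\int_{-\infty}^{\infty}\left|\frac{A+Bt}{(t^2+\lambda^2)^2}-p(t)\right|^2\frac{\mathrm dt}{|\rho_n(t)|^2}.$$ Then on the set $P_{n-1}$ the minimum of the functional $\mathcal F_n(p,\lambda)$ is attained at the polynomial $T_{n-1}(z;\lambda)$ (defined in the context), and $$\inf\{\mathcal F_n(p,\lambda):p\in P_{n-1}\}=\frac{2\pi}{\lambda\mu_n}\Bigg[\Big[\frac A\lambda+\lambda B\mathcal A_{n,\lambda}\Big]^2+\frac{3A^2+\lambda^2B^2}{2\lambda^2}+\frac{3A^2+\lambda^2B^2}{\lambda}\mathcal B_{n,\lambda}+A^2\mathcal A_{n,\lambda}^2+(A^2+\lambda^2B^2)\mathcal B_{n,\lambda}^2\Bigg],$$ where $$\mu_n=\prod_{k=1}^n\big[\alpha_k^2+(\beta_k+\lambda)^2\big],\qquad \mathcal A_{n,\lambda}=\sum_{k=1}^n\frac{\alpha_k}{\alpha_k^2+(\beta_k+\lambda)^2},\qquad \mathcal B_{n,\lambda}=\sum_{k=1}^n\frac{\beta_k+\lam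bda}{\alpha_k^2+(\beta_k+\lambda)^2}.$$
   Context: Let $\{a_k\}_{k\ge1}$ be an arbitrary sequence of points of the upper half-plane, $a_k=\alpha_k+\mathrm i\beta_k$, $\alpha_k\in\mathbb R$, $\beta_k>0$. Put $\chi_k=\frac{|1+a_k^2|}{1+a_k^2}$, $B_1(z)=1$, $B_m(z)=\prod_{k=1}^{m-1}\chi_k\frac{z-a_k}{z-\overline{a}_k}$ for $m\ge2$, and $$\Phi_m(z)=\frac{\sqrt{\operatorname{Im}a_m}}{z-\overline a_m}B_m(z),\quad m=1,2,\dots$$ This system is orthonormal on $\mathbb R$ with respect to $\langle f,g\rangle=\frac1\pi\int_{-\infty}^\infty f(x)\overline{g(x)}\,\mathrm dx$. Put $$\tau_n(z)=\prod_{k=1}^n(z-\overline a_k),\qquad R_n(z,\lambda)=\frac{A+Bz}{(z^2+\lambda^2)^2\,\tau_n(z)},$$ $$S_n(z;R_n)=\sum_{k=1}^n c_k(R_n)\Phi_k(z),\qquad c_k(R_n)=\frac1\pi\int_{-\infty}^\infty R_n(t,\lambda)\overline{\Phi_k(t)}\,\mathrm dt.$$ The polynomial $T_{n-1}(z;\lambda)$, of order $n-1$ in $z$, is defined by $T_{n-1}(z;\lambda)=\tau_n(z)S_n(z;R_n)$.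
   Formalization: The printed value of the infimum is false (F_n scales as |ρ_0|^{-2}, the printed value does not depend on ρ_0); it is multiplied by 1/(16 λ^4 |ρ_0|^2). Where a_k = i, so that χ_k is 0/0, χ_k = 1 is used. *)

(* Defs.v *)
From HB Require Import structures.
From mathcomp Require Import all_boot all_order all_algebra.
From mathcomp Require Import complex.
From mathcomp Require Import all_classical all_reals all_analysis.

Set Implicit Arguments.
Unset Strict Implicit.
Unset Printing Implicit Defensive.

Import Order.TTheory GRing.Theory Num.Theory.
Import numFieldNormedType.Exports.

Local Open Scope ring_scope.
Local Open Scope complex_scope.

(* Sequences are indexed from 1: a sequence is a function on nat whose value
   at 0 is never used. *)

(* The real-valued modulus; the generic norm on R[i] takes its values in
   R[i]. *)
Definition cmod (R : realType) (z : R[i]) : R := Normc.normc z.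

Definition cintegral (R : realType) (f : R -> R[i]) : R[i] :=
  (\int[@lebesgue_measure R]_(t in setT) complex.Re (f t))
    +i* (\int[@lebesgue_measure R]_(t in setT) complex.Im (f t)).

(* |1 + a^2| / (1 + a^2), which is 0/0 when a = i; the factor is then 1, the
   usual convention for Blaschke products. *)
Definition chi (R : realType) (a : R[i]) : R[i] :=
  if 1 + a ^+ 2 == 0 then 1 else (cmod (1 + a ^+ 2))%:C / (1 + a ^+ 2).

Definition blaschke (R : realType) (a : nat -> R[i]) (m : nat) (z : R[i]) :
    R[i] :=
  \prod_(1 <= k < m) (chi (a k) * ((z - a k) / (z - (a k)^*))).

(* The Takenaka-Malmquist functions. *)
Definition Phi (R : realType) (a : nat -> R[i]) (m : nat) (z : R[i]) : R[i] :=
  (Num.sqrt (complex.Im (a m)))%:C / (z - (a m)^*) * blaschke a m z.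

Definition tau (R : realType) (a : nat -> R[i]) (n : nat) (z : R[i]) : R[i] :=
  \prod_(1 <= k < n.+1) (z - (a k)^*).

Definition rho (R : realType) (rho0 : R[i]) (a : nat -> R[i]) (n : nat)
    (z : R[i]) : R[i] :=
  rho0 * \prod_(1 <= k < n.+1) (z - a k).

Definition Rfun (R : realType) (A B lambda : R) (a : nat -> R[i]) (n : nat)
    (z : R[i]) : R[i] :=
  (A%:C + B%:C * z) / ((z ^+ 2 + lambda%:C ^+ 2) ^+ 2 * tau a n z).

Definition fourier_coef (R : realType) (a : nat -> R[i]) (f : R[i] -> R[i])
    (k : nat) : R[i] :=
  (pi^-1)%:C * cintegral (fun t : R => f t%:C * (Phi a k t%:C)^*).

Definition fourier_sum (R : realType) (a : nat -> R[i]) (f : R[i] -> R[i])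
    (n : nat) (z : R[i]) : R[i] :=
  \sum_(1 <= k < n.+1) fourier_coef a f k * Phi a k z.

(* T is the polynomial tau_n S_n(.; R_n). The points conj a_1, ..., conj a_n,
   where the right-hand side is not defined, are excluded; T is determined by
   its values at the others. *)
Definition is_Tpoly (R : realType) (A B lambda : R) (a : nat -> R[i])
    (n : nat) (T : {poly R[i]}) : Prop :=
  forall z : R[i], (forall k : nat, (1 <= k <= n)%N -> z != (a k)^*) ->
    T.[z] = tau a n z * fourier_sum a (Rfun A B lambda a n) n z.

(* Extended-real valued, as the integral of a nonnegative function. *)
Definition Ffun (R : realType) (A B lambda : R) (a : nat -> R[i])
    (rho0 : R[i]) (n : nat) (p : {poly R[i]}) : \bar R :=
  (\int[@lebesgue_measure R]_(t in setT)
    (cmod (((A + B * t) / (t ^+ 2 + lambda ^+ 2) ^+ 2)%:C - p.[t%:C]) ^+ 2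
       / cmod (rho rho0 a n t%:C) ^+ 2)%:E)%E.

Definition mu_ (R : realType) (alpha beta : nat -> R) (lambda : R) (n : nat) :
    R :=
  \prod_(1 <= k < n.+1) (alpha k ^+ 2 + (beta k + lambda) ^+ 2).

Definition calA (R : realType) (alpha beta : nat -> R) (lambda : R) (n : nat) :
    R :=
  \sum_(1 <= k < n.+1) alpha k / (alpha k ^+ 2 + (beta k + lambda) ^+ 2).

Definition calB (R : realType) (alpha beta : nat -> R) (lambda : R) (n : nat) :
    R :=
  \sum_(1 <= k < n.+1)
    (beta k + lambda) / (alpha k ^+ 2 + (beta k + lambda) ^+ 2).

(* Main.v *)
Require Import Defs.
From HB Require Import structures.
From mathcomp Require Import all_boot all_order all_algebra.
From mathcomp Require Import complex.
From mathcomp Require Import all_classical all_reals all_analysis.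
From mathcomp Require Import unstable measurable_realfun zify ring lra.

Set Implicit Arguments.
Unset Strict Implicit.
Unset Printing Implicit Defensive.

Import Order.TTheory GRing.Theory Num.Theory.
Import numFieldNormedType.Exports.

Local Open Scope ring_scope.
Local Open Scope complex_scope.
Local Open Scope classical_set_scope.

(** The weight is governed by |rho_n| = |rho_0| |tau_n| on the real line, so
    |rho_0|^2 F_n(p) is the squared L2 distance from R_n = f / tau_n to
    p / tau_n, where f(t) = (A + B t) / (t^2 + lambda^2)^2.  The functions
    p / tau_n with deg p < n form the span of Phi_1, ..., Phi_n
    ([Takenaka_expansion]); minimizing is thus an orthogonal projection, and T
    must be tau_n times the n-th Fourier sum of R_n.

    The projection can be written down.  Put w = i lambda, let q / (z - w)^2,
    with q affine, be the principal part of R_n at its double pole in the upper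
    half-plane, and write g^# for the polynomial with the conjugate
    coefficients of g.  Then
      error = q / (z - w)^2 + (tau_n^# / tau_n) q^# / (z - conj w)^2
    has the same principal parts at w and conj w as R_n, so that
    R_n - error = T / tau_n with T a polynomial of degree < n ([defect_dvdp],
    [size_Tpoly], [error_defect]).  Against conj (p / tau_n) the first summand
    gives a rational function with all its poles in the upper half-plane and
    the second one with all its poles in the lower half-plane, both of order
    z^-2 at infinity; both integrals vanish and error is orthogonal to the span
    ([error_orthogonal]).  With [pythagoras] this proves minimality.

    The two summands of error are orthogonal for the same reason, and have the
    same modulus on the real line, so the minimum is twice the squared norm of
    q / (t - w)^2 ([error_norm]).  This norm only depends on the two
    coefficients of q, that is on the value and the logarithmic derivative of
    tau_n at w; the former has squared modulus mu_n and the latter is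
    - calA - i calB ([ppart_sqnormE], [error_norm_value]).

    The only integrals needed are that of 1 / |t - c|^2 and the vanishing of
    the integral of P / Q when the roots of Q lie on one side of the real line
    and deg P <= deg Q - 2.  The latter is Cauchy's theorem, obtained here
    without contours: dividing P successively by the linear factors of Q
    reduces to P = 1, two distinct factors of Q can be separated by partial
    fractions, a power of a single factor has a rational primitive, and two
    distinct simple factors have a primitive made of ln and atan
    ([cintegral_two_poles], [cintegral_prod_poles], [cintegral_rfrac_upper]). *)

(** * Real and imaginary parts *)

Section ComplexParts.
Variable R : realType.
Implicit Types x y z w : R[i].

Lemma complex_eq x y :
  complex.Re x = complex.Re y -> complex.Im x = complex.Im y -> x = y.
Proof. by case: x y => [? ?] [? ?] /= -> ->. Qed.

Lemma cReM x y :
  complex.Re (x * y) =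
  complex.Re x * complex.Re y - complex.Im x * complex.Im y.
Proof. by case: x y => [? ?] [? ?]. Qed.

Lemma cImM x y :
  complex.Im (x * y) =
  complex.Re x * complex.Im y + complex.Im x * complex.Re y.
Proof. by case: x y => [? ?] [? ?]. Qed.

Lemma cReD x y : complex.Re (x + y) = complex.Re x + complex.Re y.
Proof. by case: x y => [? ?] [? ?]. Qed.

Lemma cImD x y : complex.Im (x + y) = complex.Im x + complex.Im y.
Proof. by case: x y => [? ?] [? ?]. Qed.

Lemma cReN x : complex.Re (- x) = - complex.Re x.
Proof. by case: x. Qed.

Lemma cImN x : complex.Im (- x) = - complex.Im x.
Proof. by case: x. Qed.

Lemma cReV x : complex.Re x^-1 =
  complex.Re x / (complex.Re x ^+ 2 + complex.Im x ^+ 2).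
Proof. by case: x. Qed.

Lemma cImV x : complex.Im x^-1 =
  - complex.Im x / (complex.Re x ^+ 2 + complex.Im x ^+ 2).
Proof. by case: x => ? ?; rewrite mulNr. Qed.

Lemma cReJ x : complex.Re x^*%C = complex.Re x.
Proof. by case: x. Qed.

Lemma cImJ x : complex.Im x^*%C = - complex.Im x.
Proof. by case: x. Qed.

Definition ReImE :=
  (cReM, cImM, cReD, cImD, cReN, cImN, cReV, cImV, cReJ, cImJ).

(** The conjugation that [x^*] denotes inside ring operations is the generic
    one of closed fields; it is convertible to [conjc], but not for rewriting.
    All intermediate statements use [conjc]. *)
Lemma conjcM x y : (x * y)^*%C = x^*%C * y^*%C.
Proof. exact: rmorphM. Qed.

Lemma conjcD x y : (x + y)^*%C = x^*%C + y^*%C.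
Proof. exact: rmorphD. Qed.

Lemma conj_realC (t : R) : (t%:C)^*%C = t%:C.
Proof. by rewrite /= oppr0. Qed.

Definition sqnorm z : R := complex.Re z ^+ 2 + complex.Im z ^+ 2.

Lemma sqnorm_eq0 z : (sqnorm z == 0) = (z == 0).
Proof.
case: z => u v; rewrite /sqnorm /= paddr_eq0 ?sqr_ge0// !sqrf_eq0.
by rewrite eq_complex.
Qed.

Lemma sqnorm_ge0 z : 0 <= sqnorm z.
Proof. by rewrite addr_ge0 ?sqr_ge0. Qed.

Lemma sqnormM z w : sqnorm (z * w) = sqnorm z * sqnorm w.
Proof. by rewrite /sqnorm !ReImE; ring. Qed.

Lemma sqnormD z w : sqnorm (z + w) <= 2 * sqnorm z + 2 * sqnorm w.
Proof.
rewrite /sqnorm !ReImE -subr_ge0.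
set u := complex.Re z; set v := complex.Im z.
set x := complex.Re w; set y := complex.Im w.
rewrite (_ : _ - _ = (u - x) ^+ 2 + (v - y) ^+ 2); last by ring.
by rewrite addr_ge0 ?sqr_ge0.
Qed.

Lemma sqnormJ z : sqnorm z^*%C = sqnorm z.
Proof. by rewrite /sqnorm !ReImE sqrrN. Qed.

Lemma sqnormV z : sqnorm z^-1 = (sqnorm z)^-1.
Proof.
have [->|z0] := eqVneq z 0;
  first by rewrite invr0 /sqnorm /= expr0n addr0 invr0.
apply: (mulfI (x := sqnorm z)); first by rewrite sqnorm_eq0.
by rewrite -sqnormM !divff ?sqnorm_eq0// /sqnorm /= expr1n expr0n addr0.
Qed.

Lemma mulJ_sqnorm z : z * z^*%C = (sqnorm z)%:C.
Proof. by apply: complex_eq; rewrite /sqnorm !ReImE /=; ring. Qed.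

Lemma cmod_sqnorm z : cmod z ^+ 2 = sqnorm z.
Proof. by case: z => u v; rewrite /cmod /= sqr_sqrtr// addr_ge0 ?sqr_ge0. Qed.

End ComplexParts.

(** * Complex functions of a real variable *)

Section CDerive.
Variable R : realType.
Implicit Types (f g : R -> R[i]) (t : R) (c l m : R[i]).

(** Componentwise, because the variable is real while the norm on [R[i]] takes
    its values in [R[i]]. *)
Definition cderive f t l :=
  is_derive t 1 (fun s => complex.Re (f s)) (complex.Re l) /\
  is_derive t 1 (fun s => complex.Im (f s)) (complex.Im l).

Lemma cderive_eq f t l m : cderive f t l -> l = m -> cderive f t m.
Proof. by move=> ? <-. Qed.

Lemma cderive_cst c t : cderive (fun=> c) t 0.
Proof. by split; apply: is_derive_cst. Qed.

Lemma cderive_id t : cderive (fun s => s%:C) t 1.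
Proof. by split; [apply: is_derive_id | apply: is_derive_cst]. Qed.

Lemma cderiveD f g t l m : cderive f t l -> cderive g t m ->
  cderive (fun s => f s + g s) t (l + m).
Proof.
move=> [fr fi] [gr gi]; split; rewrite ReImE.
  by under eq_fun do rewrite ReImE; exact: is_deriveD.
by under eq_fun do rewrite ReImE; exact: is_deriveD.
Qed.

Lemma cderiveM f g t l m : cderive f t l -> cderive g t m ->
  cderive (fun s => f s * g s) t (l * g t + f t * m).
Proof.
move=> [fr fi] [gr gi]; split.
  under eq_fun do rewrite ReImE.
  refine (is_derive_eq (is_deriveB (is_deriveM fr gr) (is_deriveM fi gi)) _).
  by rewrite !ReImE /GRing.scale /=; ring.
under eq_fun do rewrite ReImE.
refine (is_derive_eq (is_deriveD (is_deriveM fr gi) (is_deriveM fi gr)) _).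
by rewrite !ReImE /GRing.scale /=; ring.
Qed.

Lemma cderiveX f t l (k : nat) : cderive f t l ->
  cderive (fun s => f s ^+ k) t (k%:R * f t ^+ k.-1 * l).
Proof.
move=> fl; elim: k => [|k IH].
  apply: cderive_eq; first exact: cderive_cst.
  by rewrite !mul0r.
under eq_fun do rewrite exprS.
apply: cderive_eq; first exact: (cderiveM fl IH).
case: k {IH} => [|k]; first by rewrite /=; ring.
rewrite /= exprS -[in RHS]natr1; ring.
Qed.

Lemma cderiveV f t l : f t != 0 -> cderive f t l ->
  cderive (fun s => (f s)^-1) t (- l / f t ^+ 2).
Proof.
rewrite -sqnorm_eq0 /sqnorm => ft0 [fr fi].
have h : is_derive t 1
   (fun s => (complex.Re (f s) ^+ 2 + complex.Im (f s) ^+ 2)^-1)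
   (- (2 * (complex.Re (f t) * complex.Re l +
     complex.Im (f t) * complex.Im l)) /
    (complex.Re (f t) ^+ 2 + complex.Im (f t) ^+ 2) ^+ 2).
  have h2 : is_derive t 1
      (fun s => complex.Re (f s) ^+ 2 + complex.Im (f s) ^+ 2)
      (2 * (complex.Re (f t) * complex.Re l + complex.Im (f t) * complex.Im l)).
    refine (is_derive_eq (is_deriveD (is_deriveM fr fr) (is_deriveM fi fi)) _).
    by rewrite /GRing.scale /=; ring.
  refine (is_derive_eq (@is_deriveV _ (fun s => complex.Re (f s) ^+ 2 +
    complex.Im (f s) ^+ 2)
      _ _ _ ft0 h2) _).
  by rewrite /GRing.scale /=; field.
have -> : - l / f t ^+ 2 = - l * ((f t)^-1 * (f t)^-1) by rewrite expr2 invfM.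
split.
  under eq_fun do rewrite ReImE.
  refine (is_derive_eq (is_deriveM fr h) _).
  by rewrite /GRing.scale /= !ReImE; field.
under eq_fun do rewrite ReImE.
refine (is_derive_eq (is_deriveM (is_deriveN fi) h) _).
by rewrite /GRing.scale fctE /= !ReImE; field.
Qed.

Definition cderivable f := forall t, exists l, cderive f t l.

Lemma cderivable_cst c : cderivable (fun=> c).
Proof. by move=> t; exists 0; apply: cderive_cst. Qed.

Lemma cderivable_id : cderivable (fun s => s%:C).
Proof. by move=> t; exists 1; apply: cderive_id. Qed.

Lemma cderivableD f g : cderivable f -> cderivable g -> cderivable (fun s =>
  f s + g s).
Proof.
by move=> F G t; have [l ?] := F t; have [m ?] := G t; exists (l + m);
   apply: cderiveD.
Qed.

Lemma cderivableM f g : cderivable f -> cderivable g -> cderivable (fun s =>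
  f s * g s).
Proof.
by move=> F G t; have [l ?] := F t; have [m ?] := G t; eexists;
   apply: cderiveM; eassumption.
Qed.

Lemma cderivableV f : (forall t, f t != 0) -> cderivable f ->
  cderivable (fun s => (f s)^-1).
Proof.
by move=> f0 F t; have [l ?] := F t; eexists; apply: cderiveV; eauto.
Qed.

Lemma cderivableJ f : cderivable f -> cderivable (fun s => (f s)^*%C).
Proof.
move=> F t; have [l [? ?]] := F t; exists (l^*%C); split; rewrite ReImE.
  by under eq_fun do rewrite ReImE.
by under eq_fun do rewrite ReImE; apply: is_deriveN.
Qed.

Lemma cderivable_continuous f : cderivable f ->
  continuous (fun t => complex.Re (f t)) /\
  continuous (fun t => complex.Im (f t)).
Proof.
by move=> F; split => t; have [l [fr fi]] := F t;
  apply/differentiable_continuous/derivable1_diffP; apply: ex_derive.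
Qed.

End CDerive.

(** * The fundamental theorem of calculus on the real line *)

Section RealIntegrals.
Variable R : realType.
Notation mu := (@lebesgue_measure R).

(** Dominated convergence of the truncations to [-n, n], on which the
    fundamental theorem of calculus applies. *)
Lemma integral_FTCT (f F : R -> R) (l l' : R) :
  continuous f -> mu.-integrable setT (EFin \o f) ->
  (forall x : R, is_derive x 1 F (f x)) ->
  F x @[x --> +oo] --> l -> F (- x) @[x --> +oo] --> l' ->
  (\int[mu]_x f x)%R = l - l'.
Proof.
move=> cf intf dF Fl Fl'.
(* D 0 is a single point: the formula FD below starts at n = 1. *)
pose D n : set R := `[- n%:R, n%:R]%classic.
have mD n : measurable (D n) by exact: measurable_itv.
have mf : measurable_fun [set: R] (fun x => (f x)%:E)
  by apply/measurable_EFinP; exact: continuous_measurable_fun.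
have cF : continuous F.
  by move=> x; apply/differentiable_continuous/derivable1_diffP;
    apply: ex_derive.
have FD n : (0 < n)%N ->
    (\int[mu]_(x in D n) (f x)%:E = (F n%:R - F (- n%:R))%:E)%E.
  move=> n0.
  rewrite (@continuous_FTC2 _ _ F)// ?EFinB//.
  - by rewrite -subr_gt0 opprK -natrD ltr0n addn_gt0 n0.
  - exact: continuous_subspaceT.
  - split.
    + by move=> x _; apply: ex_derive.
    + by apply: cvg_at_right_filter; exact: cF.
    + by apply: cvg_at_left_filter; exact: cF.
  - by move=> x _; rewrite derive1E; apply: derive_val.
have ny := @cvgr_idn R.
have h1 : (F n%:R - F (- n%:R))%:E @[n --> \oo] --> (l - l')%:E.
  apply/fine_cvgP; split; first exact: nearW.
  apply: cvgB; first exact: (cvg_comp _ _ ny Fl).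
  exact: (cvg_comp _ _ ny Fl').
pose g n := (fun x => (f x)%:E) \_ (D n).
have gf : \forall x \ae mu, [set: R] x -> g n x @[n --> \oo] --> (f x)%:E.
  apply: aeW => x _; apply: cvg_near_cst.
  exists (Num.bound x) => // n /= hn; rewrite /g patchE mem_set//.
  rewrite /D /= in_itv /= -ler_norml.
  by apply: ltW; apply: lt_le_trans (ltr_norm_bound x) _; rewrite ler_nat.
have g_le : \forall x \ae mu, forall n, [set: R] x ->
    (`|g n x| <= `|(f x)%:E|)%E.
  apply: aeW => x n _; rewrite /g patchE; case: ifPn => // _.
  by rewrite abse0.
have mg n : measurable_fun [set: R] (g n).
  by apply: (measurable_restrictT _ (mD n)).1; exact: measurable_funTS.
have [_ _ h2] := @dominated_convergence _ _ R mu setT measurableT g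
  (fun x => (f x)%:E) (abse \o (EFin \o f)) mg mf gf (integrable_abse intf)
    g_le.
have h3 : (\int[mu]_x (f x)%:E)%E = (l - l')%:E.
  apply: (cvg_unique _ h2) => //.
  apply: cvg_trans h1; apply: near_eq_cvg.
  exists 1%N => // n /= n0.
  by rewrite /g -integral_mkcond FD.
by rewrite /Rintegral h3.
Qed.

Lemma cvg0_le_inv (g : R -> R) (K : R) :
  (forall t, 1 <= t -> `|g t| <= K / t) -> g t @[t --> +oo] --> 0.
Proof.
move=> gK; apply/cvgrPdist_le => e e0.
near=> t.
have t1 : 1 <= t by near: t; apply: nbhs_pinfty_ge; rewrite num_real.
rewrite sub0r normrN (le_trans (gK t t1))//.
have t0 : 0 < t by exact: lt_le_trans t1.
have tK : K / e <= t by near: t; apply: nbhs_pinfty_ge; rewrite num_real.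
by rewrite ler_pdivrMr// mulrC -ler_pdivrMr.
Unshelve. all: by end_near. Qed.

Lemma integral_oneDsqr : (\int[mu]_x (1 + x ^+ 2)^-1%:E = pi%:E)%E.
Proof.
rewrite ge0_symfun_integralT.
- have -> : [set x : R | 0 <= x] = `[0, +oo[%classic.
    by apply/seteqP; split=> x /=; rewrite in_itv /= andbT.
  rewrite (_ : pi = 2 * (pi / 2)); last by field.
  by rewrite EFinM; congr (_ * _)%E; exact: integral0y_oneDsqr.
- by move=> x; rewrite invr_ge0 addr_ge0 ?sqr_ge0.
- exact: continuous_oneDsqrV.
- by move=> x /=; rewrite sqrrN.
Qed.

Lemma integrable_oneDsqr : mu.-integrable setT (EFin \o (fun x => (1 +
  x ^+ 2)^-1)).
Proof.
apply/integrableP; split.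
  apply/measurable_EFinP; apply: continuous_measurable_fun.
  exact: continuous_oneDsqrV.
under eq_integral do rewrite /= ger0_norm ?invr_ge0 ?addr_ge0 ?sqr_ge0//.
by rewrite integral_oneDsqr ltry.
Qed.

Lemma integrable_le_oneDsqr (f : R -> R) (K : R) : continuous f ->
  (forall t, `|f t| * (1 + t ^+ 2) <= K) -> mu.-integrable setT (EFin \o f).
Proof.
move=> cf fK.
apply: (le_integrable measurableT _ _
  (integrableZl measurableT K integrable_oneDsqr)).
  by apply/measurable_EFinP; exact: continuous_measurable_fun.
move=> x _; rewrite /= lee_fin.
have h : 0 < 1 + x ^+ 2 by rewrite ltr_pwDl ?sqr_ge0.
by rewrite (le_trans _ (ler_norm _))// ler_pdivlMr.
Qed.

End RealIntegrals.

(** * Decay classes and integrals of complex functions *)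

Section ComplexIntegrals.
Variable R : realType.
Implicit Types (f g F : R -> R[i]) (c d : R[i]).
Notation mu := (@lebesgue_measure R).

Lemma ler_norm_sqr (u K : R) : u ^+ 2 <= K -> `|u| <= 1 + K.
Proof.
move=> uK; have u0 := normr_ge0 u; move: uK; rewrite -real_normK ?num_real//.
by move: `|u| u0 => {}u u0 uK; nra.
Qed.

Lemma sqrD1_gt0 (t : R) : 0 < 1 + t ^+ 2.
Proof. by rewrite ltr_pwDl ?sqr_ge0. Qed.

Lemma sqrD1_ge1 (t : R) : 1 <= 1 + t ^+ 2.
Proof. by rewrite lerDl sqr_ge0. Qed.

(** [f = O(|t|^-k)] at infinity, quantified so that no case distinction on the
    size of [t] arises. The class for [k = 1] replaces L2, the one for [k = 2]
    replaces L1, and [decayM] takes the place of the Cauchy-Schwarz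
    inequality. *)
Definition decay (k : nat) f :=
  cderivable f /\ exists K, forall t, sqnorm (f t) * (1 + t ^+ 2) ^+ k <= K.

Lemma decay_le j k f : (j <= k)%N -> decay k f -> decay j f.
Proof.
move=> jk [sf [K fK]]; split=> //; exists K => t; apply: le_trans (fK t).
by rewrite ler_wpM2l ?sqnorm_ge0// ler_weXn2l// sqrD1_ge1.
Qed.

Lemma decay_cst c : decay 0 (fun=> c).
Proof.
by split; [exact: cderivable_cst|exists (sqnorm c) => t; rewrite expr0 mulr1].
Qed.

Lemma decayD k f g : decay k f -> decay k g -> decay k (fun t => f t + g t).
Proof.
move=> [sf [K fK]] [sg [L gL]]; split; first exact: cderivableD.
exists (2 * K + 2 * L) => t; have := fK t; have := gL t.
have w0 : 0 <= (1 + t ^+ 2) ^+ k by rewrite exprn_ge0// ltW// sqrD1_gt0.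
have := ler_wpM2r w0 (sqnormD (f t) (g t)); rewrite mulrDl -!mulrA.
lra.
Qed.

Lemma decayM j k f g :
  decay j f -> decay k g -> decay (j + k) (fun t => f t * g t).
Proof.
move=> [sf [K fK]] [sg [L gL]]; split; first exact: cderivableM.
exists (K * L) => t; rewrite sqnormM exprD mulrACA.
by rewrite ler_pM ?mulr_ge0 ?sqnorm_ge0 ?exprn_ge0// ltW// sqrD1_gt0.
Qed.

Lemma decayZ k c f : decay k f -> decay k (fun t => c * f t).
Proof. exact: (decayM (decay_cst c)). Qed.

Lemma decayX k f : decay 1 f -> decay k (fun t => f t ^+ k).
Proof.
move=> df; elim: k => [|k IH]; first exact: decay_cst.
by under eq_fun do rewrite exprS; exact: decayM df IH.
Qed.

Lemma decayN k f : decay k f -> decay k (fun t => - f t).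
Proof. by move=> /(decayZ (-1)); under eq_fun do rewrite mulN1r. Qed.

Lemma decayJ k f : decay k f -> decay k (fun t => (f t)^*%C).
Proof.
move=> [sf [K fK]]; split; first exact: cderivableJ.
by exists K => t; rewrite sqnormJ.
Qed.

Lemma decay_mulJ f g :
  decay 1 f -> decay 1 g -> decay 2 (fun t => f t * (g t)^*%C).
Proof. by move=> df dg; apply: (decayM df); exact: decayJ. Qed.

Lemma decay2_integrable f : decay 2 f ->
  mu.-integrable setT (EFin \o (fun t => complex.Re (f t))) /\
  mu.-integrable setT (EFin \o (fun t => complex.Im (f t))).
Proof.
move=> [sf [K fK]]; have [cr ci] := cderivable_continuous sf.
split; apply: (@integrable_le_oneDsqr _ _ (1 + K)) => // t.
  rewrite -[1 + t ^+ 2]ger0_norm ?(ltW (sqrD1_gt0 t))// -normrM ler_norm_sqr//.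
  apply: le_trans (fK t); rewrite exprMn ler_wpM2r ?sqr_ge0//.
  by rewrite lerDl sqr_ge0.
rewrite -[1 + t ^+ 2]ger0_norm ?(ltW (sqrD1_gt0 t))// -normrM ler_norm_sqr//.
apply: le_trans (fK t); rewrite exprMn ler_wpM2r ?sqr_ge0//.
by rewrite lerDr sqr_ge0.
Qed.

Lemma Re_cintegral f :
  complex.Re (cintegral f) = \int[mu]_t complex.Re (f t).
Proof. by []. Qed.

Lemma Im_cintegral f :
  complex.Im (cintegral f) = \int[mu]_t complex.Im (f t).
Proof. by []. Qed.

Lemma cintegralD f g : decay 2 f -> decay 2 g ->
  cintegral (fun t => f t + g t) = cintegral f + cintegral g.
Proof.
move=> /decay2_integrable[fr fi] /decay2_integrable[gr gi].
apply: complex_eq; rewrite !ReImE !(Re_cintegral, Im_cintegral); cbv beta.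
  by under eq_Rintegral do rewrite cReD; rewrite RintegralD.
by under eq_Rintegral do rewrite cImD; rewrite RintegralD.
Qed.

Lemma cintegralZ c f : decay 2 f ->
  cintegral (fun t => c * f t) = c * cintegral f.
Proof.
move=> /decay2_integrable[fr fi].
have iZ (k : R) (h : R -> R) : mu.-integrable setT (EFin \o h) ->
  mu.-integrable setT (EFin \o (fun t =>
    k * h t)) by move=> /(integrableZl measurableT k).
apply: complex_eq; rewrite !ReImE !(Re_cintegral, Im_cintegral); cbv beta.
  under eq_Rintegral do rewrite cReM.
  by rewrite RintegralB ?RintegralZl//; exact: iZ.
under eq_Rintegral do rewrite cImM.
by rewrite RintegralD ?RintegralZl//; exact: iZ.
Qed.

Lemma cintegralB f g : decay 2 f -> decay 2 g ->
  cintegral (fun t => f t - g t) = cintegral f - cintegral g.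
Proof.
move=> df dg; rewrite cintegralD//; last exact: decayN.
under eq_fun do rewrite -mulN1r; by rewrite cintegralZ// mulN1r.
Qed.

Lemma cintegralJ f : decay 2 f ->
  cintegral (fun t => (f t)^*%C) = (cintegral f)^*%C.
Proof.
move=> /decay2_integrable[fr fi].
apply: complex_eq; rewrite !ReImE !(Re_cintegral, Im_cintegral); cbv beta.
  by apply: eq_Rintegral => t _; rewrite ReImE.
under eq_Rintegral do rewrite cImJ -mulN1r.
by rewrite RintegralZl// mulN1r.
Qed.

Lemma Re_cintegral_sqnorm_ge0 g :
  0 <= complex.Re (cintegral (fun t => g t * (g t)^*%C)).
Proof.
rewrite Re_cintegral; apply: Rintegral_ge0 => t _.
by rewrite mulJ_sqnorm /= sqnorm_ge0.
Qed.

(** Relates the extended-real integral of the functional with the complex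
    integral in which the inner products are computed. *)
Lemma sqnorm_integral (h : R -> R[i]) (k : R) : decay 1 h ->
  (\int[mu]_t (k * sqnorm (h t))%:E =
   (k * complex.Re (cintegral (fun t => h t * (h t)^*%C)))%:E)%E.
Proof.
move=> dh; have [ih _] := decay2_integrable (decay_mulJ dh dh).
have sqE t : complex.Re (h t * (h t)^*%C) = sqnorm (h t).
  by rewrite mulJ_sqnorm.
rewrite Re_cintegral -RintegralZl// /Rintegral fineK.
  by apply: eq_integral => t _; rewrite sqE.
apply: integrable_fin_num => //.
exact: (integrableZl measurableT k ih).
Qed.

Lemma pythagoras (e g : R -> R[i]) : decay 1 e -> decay 1 g ->
  cintegral (fun t => e t * (g t)^*%C) = 0 ->
  cintegral (fun t => (e t + g t) * (e t + g t)^*%C) =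
  cintegral (fun t => e t * (e t)^*%C) + cintegral (fun t => g t * (g t)^*%C).
Proof.
move=> de dg eg0.
have dee := decay_mulJ de de; have dgg := decay_mulJ dg dg.
have deg := decay_mulJ de dg.
rewrite (_ : (fun t => _) = fun t => (e t * (e t)^*%C + g t * (g t)^*%C) +
   (e t * (g t)^*%C + (e t * (g t)^*%C)^*%C)).
  have dJ := decayJ deg.
  rewrite cintegralD ?(cintegralD dee dgg) ?(cintegralD deg dJ) ?cintegralJ//.
  - by rewrite eg0 conjc0 !addr0.
  - exact: decayD.
  - exact: decayD.
by apply/funext => t; rewrite conjcD conjcM conjcK; ring.
Qed.

(** For [s = 1] and [s = -1] this gives the limits at both ends of the line. *)
Lemma decay1_cvg0 (u : R -> R) f (s : R) : decay 1 f -> s ^+ 2 = 1 ->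
  (forall t, u t ^+ 2 <= sqnorm (f t)) -> u (s * t) @[t --> +oo] --> 0.
Proof.
move=> [_ [K fK]] s1 uf; apply: (@cvg0_le_inv _ _ (1 + K)) => t t1.
have t0 : 0 < t by exact: lt_le_trans t1.
rewrite ler_pdivlMr//.
have -> : `|u (s * t)| * t = `|u (s * t) * t| by rewrite normrM (gtr0_norm t0).
apply: ler_norm_sqr.
apply: le_trans (fK (s * t)); rewrite exprMn expr1 exprMn s1 mul1r.
by rewrite ler_pM ?sqr_ge0// lerDr.
Qed.

Lemma cintegral_FTC f F (l1 l2 m1 m2 : R) : decay 2 f ->
  (forall t, cderive F t (f t)) ->
  complex.Re (F t) @[t --> +oo] --> l1 ->
  complex.Re (F (- t)) @[t --> +oo] --> l2 ->
  complex.Im (F t) @[t --> +oo] --> m1 ->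
  complex.Im (F (- t)) @[t --> +oo] --> m2 ->
  cintegral f = (l1 - l2) +i* (m1 - m2).
Proof.
move=> df dF h1 h2 h3 h4; have [fr fi] := decay2_integrable df.
have [cr ci] := cderivable_continuous df.1.
rewrite /cintegral; congr (_ +i* _).
  by apply: integral_FTCT h1 h2 => // t; have [] := dF t.
by apply: integral_FTCT h3 h4 => // t; have [] := dF t.
Qed.

Lemma cintegral_primitive0 f F : decay 2 f -> decay 1 F ->
  (forall t, cderive F t (f t)) -> cintegral f = 0.
Proof.
move=> df dF FE; rewrite (@cintegral_FTC f F 0 0 0 0)// ?subrr//.
- under eq_cvg do rewrite -[X in F X]mul1r.
  apply: (@decay1_cvg0 (fun t => complex.Re (F t)) F) => //;
    rewrite ?expr1n// => t.
  by rewrite lerDl sqr_ge0.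
- under eq_cvg do rewrite -mulN1r.
  apply: (@decay1_cvg0 (fun t => complex.Re (F t)) F) => //;
    rewrite ?sqrrN ?expr1n// => t.
  by rewrite lerDl sqr_ge0.
- under eq_cvg do rewrite -[X in F X]mul1r.
  apply: (@decay1_cvg0 (fun t => complex.Im (F t)) F) => //;
    rewrite ?expr1n// => t.
  by rewrite lerDr sqr_ge0.
- under eq_cvg do rewrite -mulN1r.
  apply: (@decay1_cvg0 (fun t => complex.Im (F t)) F) => //;
    rewrite ?sqrrN ?expr1n// => t.
  by rewrite lerDr sqr_ge0.
Qed.

End ComplexIntegrals.

(** * Integrals of products of simple poles *)

Section Poles.
Variable R : realType.
Implicit Types (c d : R[i]) (cs : seq R[i]) (P : {poly R[i]}).

Lemma pole_neq0 c (t : R) : complex.Im c != 0 -> t%:C - c != 0.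
Proof.
apply: contraNneq => /(congr1 (@complex.Im R)) /eqP.
by rewrite !ReImE /= sub0r oppr_eq0.
Qed.

Lemma cderivable_pole c : cderivable (fun t => t%:C - c).
Proof. apply: cderivableD; [exact: cderivable_id | exact: cderivable_cst]. Qed.

Lemma cderive_pole c (t : R) : cderive (fun t => t%:C - c) t 1.
Proof.
by rewrite -[1]addr0; apply: cderiveD; [exact: cderive_id|exact: cderive_cst].
Qed.

Lemma decay_pole c : complex.Im c != 0 -> decay 1 (fun t => (t%:C - c)^-1).
Proof.
move=> c0; split.
  by apply: cderivableV; [move=> t; exact: pole_neq0|exact: cderivable_pole].
case: c c0 => x y /= y0.
(* From t^2 <= 2 (t - x)^2 + 2 x^2 and y^2 <= (t - x)^2 + y^2. *)
exists (2 + (1 + 2 * x ^+ 2) / y ^+ 2) => t.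
have y2 : 0 < y ^+ 2 by rewrite exprn_even_gt0.
rewrite sqnormV /sqnorm /= sub0r sqrrN mulrC ler_pdivrMr; last first.
  by rewrite ltr_wpDl ?sqr_ge0.
rewrite mulrDr mulrDl [_ * y ^+ 2]mulrDl divfK ?gt_eqF// expr1.
have : 0 <= (1 + 2 * x ^+ 2) / y ^+ 2 * (t - x) ^+ 2.
  apply: mulr_ge0; rewrite ?sqr_ge0//; apply: divr_ge0; rewrite ?sqr_ge0//.
  by have := sqr_ge0 x; lra.
have : 0 <= y ^+ 2 by exact: ltW.
have := sqr_ge0 (t - 2 * x).
move: (_ / _ * _) => u; nra.
Qed.

(** The primitive is a multiple of [(t - c)^-(k+1)], which vanishes at both
    ends. *)
Lemma cintegral_pole_pow c k : complex.Im c != 0 ->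
  cintegral (fun t : R => (t%:C - c)^-1 ^+ k.+2) = 0.
Proof.
move=> c0; have dc := decay_pole c0.
apply: (@cintegral_primitive0 _ _
  (fun t => - (k.+1%:R^-1) * (t%:C - c)^-1 ^+ k.+1)).
- by apply: decay_le (decayX k.+2 dc).
- by apply/decayZ; apply: decay_le (decayX k.+1 dc).
- move=> t; apply: cderive_eq.
    apply: cderiveM; first exact: cderive_cst.
    apply: cderiveX; apply: cderiveV; first exact: pole_neq0.
    exact: cderive_pole.
  have h := pole_neq0 t c0.
  have k0 : k.+1%:R != 0 :> R[i] by rewrite pnatr_eq0.
  rewrite /= mul0r add0r !exprS.
  move: ((_ - _)^-1 ^+ k) => z; move: k.+1%:R k0 => m k0.
  field.
  by rewrite h k0.
Qed.

Lemma cvgy_atan_affine (x y s : R) : 0 < y -> s ^+ 2 = 1 ->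
  atan ((s * t - x) / y) @[t --> +oo] --> s * (pi / 2).
Proof.
move=> y0 s1.
have ay : (t - s * x) / y @[t --> +oo] --> +oo.
  apply/cvgryPge => M; near=> t.
  rewrite ler_pdivlMr// lerBrDr.
  by near: t; apply: nbhs_pinfty_ge; rewrite num_real.
have -> : (fun t => atan ((s * t - x) / y)) =
    (fun t => s * atan ((t - s * x) / y)).
  apply/funext => t; have /eqP := s1; rewrite sqrf_eq1 => /orP[/eqP->|/eqP->].
    by rewrite !mul1r.
  by rewrite !mulN1r -atanN -mulNr; congr (atan (_ / _)); ring.
by apply: cvgM; [exact: cvg_cst|exact: (cvg_comp _ _ ay (@cvgy_atan R))].
Unshelve. all: by end_near. Qed.

Lemma is_derive_atan_affine (x y t : R) : 0 < y ->
  is_derive t 1 (fun t => atan ((t - x) / y)) (y / ((t - x) ^+ 2 + y ^+ 2)).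
Proof.
move=> y0.
have h : is_derive t 1 (fun t : R => (t - x) / y) y^-1.
  have h1 := is_deriveB (is_derive_id t (1 : R)) (is_derive_cst x t (1 : R)).
  refine (is_derive_eq (is_deriveM h1 (is_derive_cst y^-1 t (1 : R))) _).
  by rewrite /GRing.scale /=; ring.
refine (is_derive_eq (@is_derive1_comp _ atan (fun t => (t - x) / y) t _ _
  (is_derive1_atan _) h) _).
have y2 : (t - x) ^+ 2 + y ^+ 2 != 0.
  by rewrite gt_eqF// ltr_wpDl ?sqr_ge0// exprn_gt0.
have : 1 + ((t - x) / y) ^+ 2 != 0 by rewrite gt_eqF// sqrD1_gt0.
by move=> ?; field; rewrite y2 gt_eqF.
Qed.

Lemma cintegral_poisson c : 0 < complex.Im c ->
  cintegral (fun t : R => (t%:C - c)^-1 * (t%:C - c^*%C)^-1) =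
  (pi / complex.Im c)%:C.
Proof.
case: c => x y /= y0; have yn0 : y != 0 by rewrite gt_eqF.
have E (t : R) : (t%:C - (x +i* y))^-1 * (t%:C - (x -i* y))^-1 =
    ((t - x) ^+ 2 + y ^+ 2)^-1%:C.
  rewrite -invfM fmorphV; congr (_^-1).
  by apply: complex_eq; rewrite !ReImE /=; ring.
have L s : s ^+ 2 = 1 ->
    y^-1 * atan ((s * t - x) / y) @[t --> +oo] --> y^-1 * (s * (pi / 2)).
  by move=> s1; apply: cvgM; [exact: cvg_cst|exact: cvgy_atan_affine].
rewrite (@cintegral_FTC _ _ (fun t => (y^-1 * atan ((t - x) / y))%:C)
  (y^-1 * (1 * (pi / 2))) (y^-1 * (-1 * (pi / 2))) 0 0).
- by congr (_ +i* _); field.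
- by apply: (decayM (j := 1) (k := 1)); apply: decay_pole; rewrite /= ?oppr_eq0.
- move=> t; rewrite E; split; last exact: is_derive_cst.
  refine (is_derive_eq (is_deriveZ y^-1 (is_derive_atan_affine x t y0)) _).
  rewrite /GRing.scale /=.
  have : (t - x) ^+ 2 + y ^+ 2 != 0.
    by rewrite gt_eqF// ltr_wpDl ?sqr_ge0// exprn_gt0.
  by move=> h; field; rewrite yn0 h.
- by have := L 1 (expr1n _ _); under eq_cvg do rewrite mul1r.
- have := L (-1); rewrite sqrrN expr1n => /(_ erefl).
  by under eq_cvg do rewrite mulN1r.
- exact: cvg_cst.
- exact: cvg_cst.
Qed.

(** Makes the two logarithms in the primitive of [cintegral_two_poles], each of
    them divergent, comparable to the common reference [ln (1 + t^2)]. *)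
Lemma cvgy_ln_ratio (x y s : R) : 0 < y -> s ^+ 2 = 1 ->
  ln (((s * t - x) ^+ 2 + y ^+ 2) / (1 + t ^+ 2)) @[t --> +oo] --> (0 : R).
Proof.
move=> y0 s1.
suff h : ((s * t - x) ^+ 2 + y ^+ 2) / (1 + t ^+ 2) @[t --> +oo] --> (1 : R).
  by have := cvg_comp _ _ h (continuous_ln ltr01); rewrite ln1.
rewrite -[X in _ --> X]add0r.
under eq_cvg => t do rewrite -[_ / (1 + _)](subrK 1).
apply: cvgD; last exact: cvg_cst.
apply: (@cvg0_le_inv _ _ (2 * `|x| + (x ^+ 2 + y ^+ 2 + 1))) => t t1.
have t0 : 0 < t by exact: lt_le_trans t1.
have w0 := sqrD1_gt0 t.
have -> : ((s * t - x) ^+ 2 + y ^+ 2) / (1 + t ^+ 2) - 1 =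
    ((s ^+ 2 - 1) * t ^+ 2 - 2 * (s * (x * t)) + (x ^+ 2 + y ^+ 2 - 1)) / (1 +
      t ^+ 2).
  by field; rewrite gt_eqF.
rewrite s1 subrr mul0r sub0r normrM normfV (gtr0_norm w0) ler_pdivrMr//.
have ns : `|s| = 1 by apply/eqP; rewrite -sqr_norm_eq1 s1.
have e1 : `|- (2 * (s * (x * t))) + (x ^+ 2 + y ^+ 2 - 1)| <=
    2 * (`|x| * t) + (x ^+ 2 + y ^+ 2 + 1).
  apply: le_trans (ler_normD _ _) _; apply: lerD.
    by rewrite normrN !normrM ns mul1r (gtr0_norm t0) ger0_norm.
  by apply: le_trans (ler_normB _ _) _;
    rewrite normr1 ger0_norm// addr_ge0 ?sqr_ge0.
apply: le_trans e1 _.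
have -> : (2 * `|x| + (x ^+ 2 + y ^+ 2 + 1)) / t * (1 + t ^+ 2) =
   2 * (`|x| * t) + (x ^+ 2 + y ^+ 2 + 1) * t + (2 * `|x| + (x ^+ 2 + y ^+ 2 +
     1)) / t.
  by field; rewrite gt_eqF.
have k0 : 0 <= x ^+ 2 + y ^+ 2 + 1 by rewrite !addr_ge0 ?sqr_ge0.
rewrite -[leRHS]addrA lerD2l -[leLHS]addr0 lerD//; first by rewrite ler_peMr.
apply: divr_ge0; last exact: ltW.
by apply: addr_ge0 => //; apply: mulr_ge0.
Qed.

Lemma is_derive_ln_sqr (x y t : R) : 0 < y ->
  is_derive t 1 (fun t => 2^-1 * ln ((t - x) ^+ 2 + y ^+ 2))
    ((t - x) / ((t - x) ^+ 2 + y ^+ 2)).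
Proof.
move=> y0.
have q0 : 0 < (t - x) ^+ 2 + y ^+ 2.
  by rewrite ltr_wpDl ?sqr_ge0// exprn_gt0.
have h1 : is_derive t 1 (fun t : R => t - x) 1.
  refine (is_derive_eq (is_deriveB (is_derive_id t (1 :
    R)) (is_derive_cst x t (1 : R))) _).
  exact: subr0.
have h : is_derive t 1 (fun t : R => (t - x) ^+ 2 + y ^+ 2) (2 * (t - x)).
  refine (is_derive_eq (is_deriveD (is_deriveM h1 h1)
    (is_derive_cst (y ^+ 2) t (1 : R))) _).
  by rewrite /GRing.scale /=; ring.
refine (is_derive_eq (is_deriveZ 2^-1 (@is_derive1_comp _ (@ln R)
  (fun t => (t - x) ^+ 2 + y ^+ 2) t _ _ (is_derive1_ln q0) h)) _).
by rewrite /GRing.scale /=; field; rewrite gt_eqF.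
Qed.

(** The difference [1/(t - c) - 1/(t - d)] has a primitive whose real part is a
    difference of logarithms, tending to 0 at both ends, and whose imaginary
    part is a difference of arctangents. The latter have equal limits because
    [c] and [d] are on the same side of the real line. *)
Lemma cintegral_two_poles c d : 0 < complex.Im c -> 0 < complex.Im d ->
  c != d ->
  cintegral (fun t : R => (t%:C - c)^-1 * (t%:C - d)^-1) = 0.
Proof.
move=> c0 d0 cd.
have cn0 : complex.Im c != 0 by rewrite gt_eqF.
have dn0 : complex.Im d != 0 by rewrite gt_eqF.
have dcd : decay 2 (fun t : R => (t%:C - c)^-1 * (t%:C - d)^-1).
  by apply: (decayM (j := 1) (k := 1)); exact: decay_pole.
apply: (mulfI (x := c - d)); first by rewrite subr_eq0.
rewrite mulr0 -cintegralZ//.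
pose lg (c : R[i]) (t : R) :=
  2^-1 * ln ((t - complex.Re c) ^+ 2 + complex.Im c ^+ 2).
have lgE (s t : R) : s ^+ 2 = 1 -> lg c (s * t) - lg d (s * t) =
    2^-1 * ln (((s * t - complex.Re c) ^+ 2 + complex.Im c ^+ 2) / (1 +
      t ^+ 2)) -
    2^-1 * ln (((s * t - complex.Re d) ^+ 2 + complex.Im d ^+ 2) / (1 +
      t ^+ 2)).
  have w0 := sqrD1_gt0 t; move=> s1.
  rewrite !ln_div ?posrE// ?ltr_wpDl ?sqr_ge0 ?exprn_gt0//.
  by rewrite /lg; ring.
have lgcd (s : R) : s ^+ 2 = 1 ->
    lg c (s * t) - lg d (s * t) @[t --> +oo] --> (0 : R).
  move=> s1.
  have h z : 0 < complex.Im z -> 2^-1 * ln (((s * t - complex.Re z) ^+ 2 +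
      complex.Im z ^+ 2) / (1 + t ^+ 2)) @[t --> +oo] --> 2^-1 * (0 : R).
    by move=> z0; apply: cvgM; [exact: cvg_cst|exact: cvgy_ln_ratio].
  rewrite (_ : (fun t => _) = (fun t =>
    2^-1 * ln (((s * t - complex.Re c) ^+ 2 + complex.Im c ^+ 2) / (1 +
      t ^+ 2)) -
    2^-1 * ln (((s * t - complex.Re d) ^+ 2 + complex.Im d ^+ 2) / (1 +
      t ^+ 2))));
    last by apply/funext => t; exact: lgE.
  have -> : 0 = 2^-1 * 0 - 2^-1 * 0 :> R by rewrite subrr.
  by apply: cvgB; exact: h.
pose ag (c : R[i]) (t : R) := atan ((t - complex.Re c) / complex.Im c).
rewrite (@cintegral_FTC _ _ (fun t => (lg c t - lg d t) +i* (ag c t - ag d t))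
  0 0 (1 * (pi / 2) - 1 * (pi / 2)) (-1 * (pi / 2) - -1 * (pi / 2))).
- by rewrite !subrr.
- exact: decayZ.
- move=> t; have hc := pole_neq0 t cn0; have hd := pole_neq0 t dn0.
  have -> : (c - d) * ((t%:C - c)^-1 * (t%:C - d)^-1) =
      (t%:C - c)^-1 - (t%:C - d)^-1 by field; rewrite hc hd.
  split; rewrite !ReImE /= ?sub0r ?sqrrN ?opprK.
    exact: is_deriveB (is_derive_ln_sqr _ _ c0) (is_derive_ln_sqr _ _ d0).
  exact: is_deriveB (is_derive_atan_affine _ _ c0) (is_derive_atan_affine _ _
    d0).
- by under eq_cvg do rewrite /= -[X in lg c X]mul1r -[X in lg d X]mul1r;
    apply: lgcd; rewrite expr1n.
- by under eq_cvg do rewrite /= -mulN1r; apply: lgcd; rewrite sqrrN expr1n.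
- by under eq_cvg do rewrite /= -[X in ag c X]mul1r -[X in ag d X]mul1r;
    apply: cvgB; apply: cvgy_atan_affine; rewrite ?expr1n.
- by under eq_cvg do rewrite /= -mulN1r; apply: cvgB; apply: cvgy_atan_affine;
    rewrite ?sqrrN ?expr1n.
Qed.

Lemma decay_prod_poles cs : all (fun c => complex.Im c != 0) cs ->
  decay (size cs) (fun t : R => \prod_(c <- cs) (t%:C - c)^-1).
Proof.
elim: cs => [_|c cs IH /= /andP[c0 /IH{}IH]].
  by under eq_fun do rewrite big_nil; exact: decay_cst.
by under eq_fun do rewrite big_cons; apply: decayM (decay_pole c0) IH.
Qed.

(** Induction on the number of factors: if all of them agree, there is an
    explicit primitive; otherwise two distinct ones are separated by partial
    fractions, which leaves two products with one factor less. *)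
Lemma cintegral_prod_poles cs : all (fun c => 0 < complex.Im c) cs ->
  (1 < size cs)%N ->
  cintegral (fun t : R => \prod_(c <- cs) (t%:C - c)^-1) = 0.
Proof.
move: {2}(size cs) (erefl (size cs)) => m.
elim: m cs => [|m IH] [|c cs]//= [szm] /andP[c0 csup] cs1.
have cn0 : complex.Im c != 0 by rewrite gt_eqF.
have [cseq|/allPn[d dcs dc]] := boolP (all (pred1 c) cs).
  have {cseq csup} -> : cs = nseq m c by rewrite -szm; apply/all_pred1P.
  case: m szm {IH} => [|m] szm; first by rewrite szm in cs1.
  under eq_fun do rewrite big_cons big_nseq iter_mulr_1 -exprS.
  by rewrite -(cintegral_pole_pow m cn0).
have pcs := perm_to_rem dcs; set cs' := rem d cs in pcs.
have szcs : size cs = (size cs').+1 by rewrite (perm_size pcs).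
move: csup; rewrite (perm_all _ pcs) /= => /andP[d0 cs'0].
have dn0 : complex.Im d != 0 by rewrite gt_eqF.
under eq_fun do rewrite big_cons (perm_big _ pcs) big_cons mulrA.
case cs'E : cs' szcs => [|e cs''] szcs.
  under eq_fun do rewrite big_nil mulr1.
  by apply: cintegral_two_poles => //; rewrite eq_sym.
rewrite -cs'E in szcs *.
have cs'n0 : all (fun c => complex.Im c != 0) cs'.
  by apply: sub_all cs'0 => z z0; rewrite gt_eqF.
have key z : 0 < complex.Im z -> decay 2 (fun t : R =>
    (t%:C - z)^-1 * \prod_(j <- cs') (t%:C - j)^-1) /\
    cintegral (fun t : R => (t%:C - z)^-1 * \prod_(j <- cs') (t%:C - j)^-1) = 0.
  move=> z0; have prodE : (fun t : R => (t%:C - z)^-1 * \prod_(j <- cs') (t%:C -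
    j)^-1) =
      (fun t : R => \prod_(j <- z :: cs') (t%:C - j)^-1).
    by apply/funext => t; rewrite big_cons.
  rewrite prodE; split; last first.
    by apply: IH; [rewrite /= -szcs|rewrite /= z0|rewrite cs'E].
  apply: (@decay_le _ 2 (size (z :: cs'))); first by rewrite cs'E.
  by apply: decay_prod_poles; rewrite /= gt_eqF.
have [dc' ic] := key c c0; have [dd id] := key d d0.
apply: (mulfI (x := c - d)); first by rewrite subr_eq0 eq_sym.
rewrite mulr0 -cintegralZ; last first.
  have prodE : (fun t : R => (t%:C - c)^-1 * (t%:C -
    d)^-1 * \prod_(j <- cs') (t%:C - j)^-1) =
      (fun t : R => \prod_(j <- [:: c, d & cs']) (t%:C - j)^-1).
    by apply/funext => t; rewrite !big_cons mulrA.
  rewrite prodE; apply: (@decay_le _ 2 (size [:: c, d & cs'])) => //.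
  by apply: decay_prod_poles; rewrite /= cn0 dn0.
transitivity (cintegral (fun t : R =>
  (t%:C - c)^-1 * \prod_(j <- cs') (t%:C - j)^-1 -
  (t%:C - d)^-1 * \prod_(j <- cs') (t%:C - j)^-1)).
  congr cintegral; apply/funext => t.
  have hc := pole_neq0 t cn0; have hd := pole_neq0 t dn0.
  by field; rewrite hc hd.
by rewrite cintegralB// ic id subrr.
Qed.

End Poles.

(** * One-sided rational functions have integral zero *)

Section RationalFunctions.
Variable R : realType.
Implicit Types (c d : R[i]) (cs : seq R[i]) (P : {poly R[i]}).

Definition rfrac P cs (t : R) : R[i] :=
  P.[t%:C] * \prod_(c <- cs) (t%:C - c)^-1.

Lemma poly_divX P c :
  exists Q : {poly R[i]}, P = P.[c]%:P + ('X - c%:P) * Q /\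
    size Q = (size P).-1.
Proof.
have : root (P - P.[c]%:P) c by rewrite /root !hornerE subrr.
move=> /factor_theorem[Q PQ]; exists Q; split.
  by rewrite mulrC -PQ addrC subrK.
have [Q0|Q0] := eqVneq Q 0.
  move/eqP: PQ; rewrite Q0 mul0r subr_eq0 => /eqP ->.
  by rewrite size_poly0 size_polyC; case: (_ == _).
have szQ : size (Q * ('X - c%:P)) =
  (size Q).+1 by rewrite size_Mmonic ?monicXsubC// size_XsubC addn2.
suff -> : size P = (size Q).+1 by [].
rewrite -szQ -PQ size_polyDl// size_polyN.
have : (1 < size (P - P.[c]%:P)%R)%N by rewrite PQ szQ ltnS lt0n size_poly_eq0.
rewrite ltnNge; apply: contraNltn => h.
rewrite (leq_trans (size_polyD _ _))// size_polyN geq_max.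
by rewrite (leq_trans h)//= ?size_polyC_leq1.
Qed.

Lemma rfrac0 cs t : rfrac 0 cs t = 0.
Proof. by rewrite /rfrac horner0 mul0r. Qed.

Lemma rfracM P Q cs ds t :
  rfrac P cs t * rfrac Q ds t = rfrac (P * Q) (cs ++ ds) t.
Proof. by rewrite /rfrac hornerM big_cat mulrACA. Qed.

(** One step of the expansion of a rational function along its list of poles;
    it carries both estimates and integrals from products of poles to
    [rfrac]. *)
Lemma rfrac_cons P Q a c cs t : complex.Im c != 0 ->
  P = a%:P + ('X - c%:P) * Q ->
  rfrac P (c :: cs) t =
  a * \prod_(d <- c :: cs) (t%:C - d)^-1 + rfrac Q cs t.
Proof.
move=> c0 ->; rewrite /rfrac !hornerE !big_cons.
have h := pole_neq0 t c0.
by field.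
Qed.

Lemma decay_rfrac k P cs : all (fun c => complex.Im c != 0) cs ->
  (size P + k <= (size cs).+1)%N -> decay k (rfrac P cs).
Proof.
have decay0 cs' : decay k (rfrac 0 cs').
  rewrite (_ : rfrac 0 cs' = (fun=> 0)); last by apply/funext => t;
    rewrite rfrac0.
  split; first exact: cderivable_cst.
  by exists 0 => t; rewrite /sqnorm /= expr0n addr0 mul0r.
elim: cs P => [|c cs IH] P.
  have [->//|P0] := eqVneq P 0.
  move=> _ szP; have /size_poly1P[a _ ->] : size P == 1%N.
    by rewrite eqn_leq size_poly_gt0 P0 andbT (leq_trans _ szP)// leq_addr.
  have -> : k = 0%N.
    have : (0 < size P)%N by rewrite size_poly_gt0.
    by move: szP; rewrite /=; case: (size P) => // m;
      rewrite addSn ltnS leqn0 addn_eq0 => /andP[_ /eqP].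
  rewrite (_ : rfrac _ _ = fun=> a); first exact: decay_cst.
  by apply/funext => t; rewrite /rfrac hornerC big_nil mulr1.
move=> /= /andP[c0 cs0] szP.
have [->//|P0] := eqVneq P 0.
have Pgt0 : (0 < size P)%N by rewrite size_poly_gt0.
have [Q [PQ szQ]] := poly_divX P c.
rewrite (_ : rfrac _ _ = fun t =>
  P.[c] * \prod_(d <- c :: cs) (t%:C - d)^-1 + rfrac Q cs t); last first.
  by apply/funext => t; exact: rfrac_cons.
apply: decayD; last by apply: IH => //; rewrite szQ -ltnS -addSn prednK.
apply/decayZ; apply: (@decay_le _ k (size (c :: cs))).
  by rewrite -ltnS (leq_trans _ szP)// -add1n leq_add2r.
by apply: decay_prod_poles; rewrite /= c0.
Qed.

(** Cauchy theorem for the upper half-plane. Since [size P] exceeds the degree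
    by one, the hypothesis says that the degree of the quotient is at most
    -2. *)
Lemma cintegral_rfrac_upper P cs : all (fun c => 0 < complex.Im c) cs ->
  (size P < size cs)%N -> cintegral (rfrac P cs) = 0.
Proof.
have int0 cs' : cintegral (rfrac 0 cs' : R -> R[i]) = 0.
  rewrite (_ : rfrac 0 cs' = (fun t => 0 * (t%:C - 'i)^-1 ^+ 2)); last first.
    by apply/funext => t; rewrite rfrac0 mul0r.
  rewrite cintegralZ ?mul0r//; apply: decayX; apply: decay_pole.
  by rewrite /= oner_eq0.
elim: cs P => [|c cs IH] P //= /andP[c0 cs0] szP.
have [->//|P0] := eqVneq P 0.
have Pgt0 : (0 < size P)%N by rewrite size_poly_gt0.
have cn0 : complex.Im c != 0 by rewrite gt_eqF.
have csn0 : all (fun c => complex.Im c != 0) cs.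
  by apply: sub_all cs0 => d d0; rewrite gt_eqF.
have [Q [PQ szQ]] := poly_divX P c.
have szQcs : (size Q < size cs)%N by rewrite szQ -ltnS prednK.
have sz2 : (1 < size (c :: cs))%N by rewrite (leq_trans _ szP)// ltnS.
rewrite (_ : rfrac _ _ = fun t =>
  P.[c] * \prod_(d <- c :: cs) (t%:C - d)^-1 + rfrac Q cs t); last first.
  by apply/funext => t; exact: rfrac_cons.
have dp : decay 2 (fun t : R => \prod_(d <- c :: cs) (t%:C - d)^-1).
  by apply: decay_le sz2 _; apply: decay_prod_poles; rewrite /= cn0.
rewrite cintegralD ?cintegralZ//; first last.
- by apply: decay_rfrac => //; rewrite addn2 !ltnS.
- exact: decayZ.
by rewrite cintegral_prod_poles ?mulr0 ?add0r ?IH//= c0.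
Qed.

Lemma map_conjcK P : map_poly conjc (map_poly conjc P) = P.
Proof. by apply/polyP => i; rewrite !coef_map /= conjcK. Qed.

Lemma map_conjc_sqr_XsubC c :
  map_poly conjc (('X - c%:P) ^+ 2) = ('X - (c^*%C)%:P) ^+ 2.
Proof. by rewrite rmorphXn rmorphB /= map_polyX map_polyC. Qed.

Lemma conj_horner P (z : R[i]) : (P.[z])^*%C = (map_poly conjc P).[z^*%C].
Proof. by rewrite horner_map. Qed.

Lemma conj_rfrac P cs t :
  (rfrac P cs t)^*%C = rfrac (map_poly conjc P) (map conjc cs) t.
Proof.
rewrite /rfrac rmorphM; congr (_ * _).
  by rewrite -[LHS]/((P.[t%:C])^*%C) conj_horner; congr (_.[_]);
    exact: conj_realC.
rewrite -[LHS]/((\prod_(c <- cs) (t%:C - c)^-1)^*%C) rmorph_prod big_map;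
  apply: eq_bigr => c _.
by rewrite fmorphV rmorphB; congr ((_ - _)^-1); exact: conj_realC.
Qed.

Lemma cintegral_rfrac_lower P cs : all (fun c => complex.Im c < 0) cs ->
  (size P < size cs)%N -> cintegral (rfrac P cs) = 0.
Proof.
move=> cs0 szP.
have -> : rfrac P cs =
    fun t => (rfrac (map_poly conjc P) (map conjc cs) t)^*%C.
  by apply/funext => t; rewrite -conj_rfrac conjcK.
have cs1 : all (fun c => 0 < complex.Im c) (map conjc cs).
  by rewrite all_map; apply: sub_all cs0 => -[x y] /= y0; rewrite oppr_gt0.
rewrite cintegralJ ?cintegral_rfrac_upper ?conjc0 ?size_map ?size_map_poly//.
apply: decay_rfrac; last by rewrite size_map_poly size_map addn2 !ltnS.
by apply: sub_all cs1 => d d0; rewrite gt_eqF.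
Qed.

End RationalFunctions.

(** * The Takenaka-Malmquist system *)

Section TakenakaMalmquist.
Variables (R : realType) (a : nat -> R[i]).
Hypothesis a_gt0 : forall k, (1 <= k)%N -> 0 < complex.Im (a k).
Implicit Types (p q : {poly R[i]}) (k m n : nat).

(** The nodes, in the upper half-plane, and their conjugates, in the lower one;
    [lpoly n] is tau_n and [upoly n] is rho_n up to its constant factor. *)
Definition ups n := [seq a k | k <- index_iota 1 n.+1].
Definition lows n := map conjc (ups n).
Definition upoly n : {poly R[i]} := \prod_(c <- ups n) ('X - c%:P).
Definition lpoly n : {poly R[i]} := \prod_(c <- lows n) ('X - c%:P).

Lemma ups_rcons n : ups n.+1 = rcons (ups n) (a n.+1).
Proof. by rewrite /ups /index_iota !subSS !subn0 -(addn1 n) iotaD map_cat cats1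
  addn1. Qed.

Lemma lows_rcons n : lows n.+1 = rcons (lows n) (a n.+1)^*%C.
Proof. by rewrite /lows ups_rcons map_rcons. Qed.

Lemma size_ups n : size (ups n) = n.
Proof. by rewrite size_map size_iota subSS subn0. Qed.

Lemma size_lows n : size (lows n) = n.
Proof. by rewrite size_map size_ups. Qed.

Lemma size_upoly n : size (upoly n) = n.+1.
Proof. by rewrite size_prod_XsubC size_ups. Qed.

Lemma size_lpoly n : size (lpoly n) = n.+1.
Proof. by rewrite size_prod_XsubC size_lows. Qed.

Lemma ups_gt0 n : all (fun c => 0 < complex.Im c) (ups n).
Proof.
by apply/allP => c /mapP[k]; rewrite mem_index_iota => /andP[k1 _] ->;
  exact: a_gt0.
Qed.

Lemma lows_lt0 n : all (fun c => complex.Im c < 0) (lows n).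
Proof.
rewrite /lows all_map; apply: sub_all (ups_gt0 n) => -[x y] /= y0.
by rewrite oppr_lt0.
Qed.

Lemma ups_neq0 n : all (fun c => complex.Im c != 0) (ups n).
Proof. by apply: sub_all (ups_gt0 n) => c c0; rewrite gt_eqF. Qed.

Lemma lows_neq0 n : all (fun c => complex.Im c != 0) (lows n).
Proof. by apply: sub_all (lows_lt0 n) => c c0; rewrite lt_eqF. Qed.

Lemma tau_lpoly n z : tau a n z = (lpoly n).[z].
Proof.
rewrite /tau /lpoly horner_prod /lows /ups !big_map.
by apply: eq_bigr => k _; rewrite !hornerE.
Qed.

Lemma rho_upoly (rho0 : R[i]) n z : rho rho0 a n z = rho0 * (upoly n).[z].
Proof.
rewrite /rho /upoly horner_prod /ups !big_map; congr (_ * _).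
by apply: eq_bigr => k _; rewrite !hornerE.
Qed.

Lemma map_conjc_upoly n : map_poly conjc (upoly n) = lpoly n.
Proof.
rewrite rmorph_prod /lpoly /lows big_map; apply: eq_bigr => c _.
by rewrite rmorphB /= map_polyX map_polyC.
Qed.

Lemma map_conjc_lpoly n : map_poly conjc (lpoly n) = upoly n.
Proof. by rewrite -map_conjc_upoly map_conjcK. Qed.

Lemma upoly_neq0 n (t : R) : (upoly n).[t%:C] != 0.
Proof.
rewrite horner_prod prodf_seq_neq0; apply/allP => c /(allP (ups_neq0 n)) c0.
by rewrite !hornerE; exact: pole_neq0.
Qed.

Lemma lpoly_neq0 n (t : R) : (lpoly n).[t%:C] != 0.
Proof.
rewrite horner_prod prodf_seq_neq0; apply/allP => c /(allP (lows_neq0 n)) c0.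
by rewrite !hornerE; exact: pole_neq0.
Qed.

Lemma conj_upoly n (t : R) : ((upoly n).[t%:C])^*%C = (lpoly n).[t%:C].
Proof. by rewrite conj_horner map_conjc_upoly; congr (_.[_]);
  exact: conj_realC. Qed.

Lemma conj_lpoly n (t : R) : ((lpoly n).[t%:C])^*%C = (upoly n).[t%:C].
Proof. by rewrite conj_horner map_conjc_lpoly; congr (_.[_]);
  exact: conj_realC. Qed.

Lemma prod_ups n (t : R) : \prod_(c <- ups n) (t%:C - c)^-1 =
  ((upoly n).[t%:C])^-1.
Proof.
by rewrite horner_prod -prodfV; apply: eq_bigr => c _; rewrite !hornerE.
Qed.

Lemma prod_lows n (t : R) : \prod_(c <- lows n) (t%:C - c)^-1 =
  ((lpoly n).[t%:C])^-1.
Proof.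
by rewrite horner_prod -prodfV; apply: eq_bigr => c _; rewrite !hornerE.
Qed.

Lemma rfrac_lows p n (t : R) : rfrac p (lows n) t = p.[t%:C] / (lpoly n).[t%:C].
Proof. by rewrite /rfrac prod_lows. Qed.

Lemma conj_rfrac_lows p n (t : R) :
  (rfrac p (lows n) t)^*%C = (map_poly conjc p).[t%:C] / (upoly n).[t%:C].
Proof.
rewrite conj_rfrac /rfrac -prod_ups /lows -map_comp.
by under eq_map do rewrite /= conjcK; rewrite map_id.
Qed.

Lemma lpolyS n : lpoly n.+1 = lpoly n * ('X - (a n.+1)^*%C%:P).
Proof. by rewrite /lpoly lows_rcons -cats1 big_cat big_seq1. Qed.

(** The constant factor of [Phi_(m+1)]; its squared modulus is [Im a_(m+1)],
    each [chi] being unimodular. *)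
Definition uconst m : R[i] :=
  (Num.sqrt (complex.Im (a m.+1)))%:C * \prod_(1 <= k < m.+1) chi (a k).

Lemma sqnorm_chi (c : R[i]) : sqnorm (chi c) = 1.
Proof.
rewrite /chi; case: eqP => [_|/eqP c0].
  by rewrite /sqnorm /= expr1n expr0n addr0.
rewrite sqnormM sqnormV /sqnorm /= expr0n addr0 cmod_sqnorm divff//.
by rewrite sqnorm_eq0.
Qed.

Lemma sqnorm_uconst m : sqnorm (uconst m) = complex.Im (a m.+1).
Proof.
rewrite sqnormM [X in _ * X](_ : _ = 1).
  by rewrite mulr1 /sqnorm /= expr0n addr0 sqr_sqrtr// ltW// a_gt0.
elim/big_rec: _ => [|k z _ IH]; first by rewrite /sqnorm /= expr1n expr0n addr0.
by rewrite sqnormM sqnorm_chi IH mulr1.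
Qed.

Lemma uconst_neq0 m : uconst m != 0.
Proof. by rewrite -sqnorm_eq0 sqnorm_uconst gt_eqF// a_gt0. Qed.

Lemma Phi_lpoly m z : (forall k, (1 <= k <= m.+1)%N -> z != (a k)^*%C) ->
  Phi a m.+1 z = uconst m * ((upoly m).[z] / (lpoly m.+1).[z]).
Proof.
move=> hz; rewrite /Phi /blaschke big_split prodf_div /=.
have -> : \prod_(1 <= i < m.+1) (z - (a i)^*%C) =
  (lpoly m).[z] by rewrite -tau_lpoly.
have -> : \prod_(1 <= i < m.+1) (z - a i) = (upoly m).[z].
  by rewrite -[RHS]mul1r -rho_upoly /rho mul1r.
rewrite lpolyS hornerM hornerXsubC /uconst.
have h1 : z - (a m.+1)^*%C != 0 by rewrite subr_eq0 hz//= leqnn.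
have h2 : (lpoly m).[z] != 0.
  rewrite -tau_lpoly /tau prodf_seq_neq0; apply/allP => k.
  rewrite mem_index_iota => /andP[k1 km] /=; rewrite subr_eq0 hz// k1/=.
  by rewrite ltnW.
by field; rewrite h1 h2.
Qed.

Lemma Phi_rfrac m (t : R) :
  Phi a m.+1 t%:C = uconst m * rfrac (upoly m) (lows m.+1) t.
Proof.
rewrite rfrac_lows Phi_lpoly// => k /andP[k1 _].
apply: contraTneq (a_gt0 k1) => /(congr1 (@complex.Im R)).
by case: (a k) => x y /= /esym/eqP; rewrite oppr_eq0 => /eqP ->; rewrite ltxx.
Qed.

Lemma decay_lows p n : (size p <= n)%N -> decay 1 (rfrac p (lows n)).
Proof.
move=> szp; apply: decay_rfrac; first exact: lows_neq0.
by rewrite size_lows addn1 ltnS.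
Qed.

Lemma decay_Phi m : decay 1 (fun t : R => Phi a m.+1 t%:C).
Proof.
under eq_fun do rewrite Phi_rfrac.
by apply/decayZ/decay_lows; rewrite size_upoly.
Qed.

(** The numerator [upoly m] of [Phi] cancels the poles of the conjugated
    factor, so all the poles that remain are in the lower half-plane. *)
Lemma Phi_orthogonal p m : (size p <= m)%N ->
  cintegral (fun t : R => Phi a m.+1 t%:C * (rfrac p (lows m) t)^*%C) = 0.
Proof.
move=> szp.
rewrite (_ : (fun _ => _) = fun t =>
    uconst m * rfrac (map_poly conjc p) (lows m.+1) t).
  have szp' : (size (map_poly conjc p) <= m)%N by rewrite size_map_poly.
  rewrite cintegralZ; last first.
    apply: decay_rfrac; first exact: lows_neq0.
    by rewrite size_lows addn2 !ltnS.
  rewrite cintegral_rfrac_lower ?mulr0//; first exact: lows_lt0.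
  by rewrite size_lows ltnS.
apply/funext => t; rewrite Phi_rfrac conj_rfrac_lows !rfrac_lows.
have h1 := upoly_neq0 m t; have h2 := lpoly_neq0 m.+1 t.
by field; rewrite h1 h2.
Qed.

Lemma Phi_orthogonal_sym p m : (size p <= m)%N ->
  cintegral (fun t : R => rfrac p (lows m) t * (Phi a m.+1 t%:C)^*%C) = 0.
Proof.
move=> szp.
rewrite (_ : (fun _ => _) = fun t : R =>
    (Phi a m.+1 t%:C * (rfrac p (lows m) t)^*%C)^*%C).
  rewrite cintegralJ ?Phi_orthogonal ?conjc0//.
  by apply: decay_mulJ; [exact: decay_Phi|exact: decay_lows].
by apply/funext => t; rewrite conjcM conjcK mulrC.
Qed.

(** A Blaschke product is unimodular on the real line, which leaves a Poisson
    kernel. *)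
Lemma Phi_norm m :
  cintegral (fun t : R => Phi a m.+1 t%:C * (Phi a m.+1 t%:C)^*%C) = pi%:C.
Proof.
have b0 := a_gt0 (ltn0Sn m).
rewrite (_ : (fun _ => _) = fun t : R => (complex.Im (a m.+1))%:C *
    ((t%:C - a m.+1)^-1 * (t%:C - (a m.+1)^*%C)^-1)).
  rewrite cintegralZ; last first.
    apply: (decayM (j := 1) (k := 1)); apply: decay_pole.
      by rewrite gt_eqF.
    by rewrite cImJ oppr_eq0 gt_eqF.
  rewrite cintegral_poisson// -rmorphM; congr (_%:C).
  by rewrite mulrC divfK// gt_eqF.
apply/funext => t; rewrite Phi_rfrac -sqnorm_uconst -mulJ_sqnorm.
rewrite conjcM conj_rfrac_lows rfrac_lows map_conjc_upoly lpolyS.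
have -> : (upoly m.+1).[t%:C] = (upoly m).[t%:C] * (t%:C - a m.+1).
  by rewrite /upoly ups_rcons -cats1 big_cat big_seq1 hornerM hornerXsubC.
rewrite hornerM hornerXsubC.
have h1 := upoly_neq0 m t; have h2 := lpoly_neq0 m t.
have h3 : t%:C - a m.+1 != 0 by apply: pole_neq0; rewrite gt_eqF.
have h4 : t%:C - (a m.+1)^*%C != 0.
  by apply: pole_neq0; rewrite cImJ oppr_eq0 gt_eqF.
by field; rewrite h1 h2 h3 h4.
Qed.

(** Lets [Phi_k], for [k <= n], be used as one of the functions [q / tau_n]. *)
Lemma rfrac_lows_widen p m n : (m <= n)%N -> (size p <= m)%N ->
  exists2 q : {poly R[i]}, (size q <= n)%N &
    rfrac p (lows m) =1 rfrac q (lows n).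
Proof.
move=> mn szp; elim: n mn => [|n IH].
  by rewrite leqn0 => /eqP m0; exists p; rewrite -?m0.
rewrite leq_eqVlt => /predU1P[mn|]; first by exists p; rewrite -?mn.
rewrite ltnS => /IH[q szq pq]; exists (q * ('X - (a n.+1)^*%C%:P)).
  rewrite (leq_trans (size_polyMleq _ _))// size_XsubC addn2 /=.
  by rewrite ltnS.
move=> t; rewrite pq !rfrac_lows lpolyS !hornerM.
have h1 := lpoly_neq0 n t.
have h2 : ('X - (a n.+1)^*%C%:P).[t%:C] != 0.
  rewrite hornerXsubC; apply: pole_neq0.
  by rewrite cImJ oppr_eq0 gt_eqF// a_gt0.
by field; rewrite h1 h2.
Qed.

(** Induction on [n]: subtracting from [p / tau_(n+1)] the multiple of
    [Phi_(n+1)] whose numerator agrees with [p] at [conj a_(n+1)] leaves some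
    [q / tau_n]; by orthonormality neither of the two parts disturbs the
    coefficients of the other. *)
Lemma Takenaka_expansion n p z : (size p <= n)%N ->
  (forall k, (1 <= k <= n)%N -> z != (a k)^*%C) ->
  p.[z] = tau a n z * \sum_(1 <= k < n.+1) (pi^-1)%:C *
    cintegral (fun t : R => rfrac p (lows n) t * (Phi a k t%:C)^*%C) * Phi a k
      z.
Proof.
elim: n p => [|n IH] p szp hz.
  by move: szp; rewrite leqn0 size_poly_eq0 => /eqP->;
    rewrite horner0 big_nil mulr0.
set b := (a n.+1)^*%C.
have ub : (upoly n).[b] != 0.
  rewrite horner_prod prodf_seq_neq0; apply/allP => c /(allP (ups_gt0 n)) c0 /=.
  rewrite hornerXsubC; apply: contraTneq c0 => /(congr1 (@complex.Im R)).
  have := a_gt0 (ltn0Sn n).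
  rewrite /b; case: (a n.+1) c => [x y] [x' y'] /= y0 /eqP.
  by rewrite -opprD oppr_eq0 addr_eq0 => /eqP yy; rewrite -leNgt; lra.
(* upoly n does not vanish at b, so d can be chosen to cancel the pole at b. *)
pose d := p.[b] / (uconst n * (upoly n).[b]).
have un0 := uconst_neq0 n.
have : root (p - (d * uconst n) *: upoly n) b.
  rewrite /root hornerD hornerN hornerZ /d; apply/eqP.
  by field; rewrite un0 ub.
move=> /factor_theorem[q pq].
have szq : (size q <= n)%N.
  have [->|q0] := eqVneq q 0; first by rewrite size_poly0.
  have : (size (p - (d * uconst n) *: upoly n)%R <= n.+1)%N.
    rewrite (leq_trans (size_polyD _ _))// size_polyN geq_max szp.
    by rewrite (leq_trans (size_scale_leq _ _))// size_upoly.
  by rewrite pq size_Mmonic ?monicXsubC// size_XsubC addn2.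
have pE t : rfrac p (lows n.+1) t = d * Phi a n.+1 t%:C + rfrac q (lows n) t.
  have -> : p = (d * uconst n) *: upoly n + q * ('X - b%:P).
    by rewrite -pq addrC subrK.
  rewrite Phi_rfrac !rfrac_lows lpolyS hornerD hornerZ !hornerM hornerXsubC.
  have h1 := lpoly_neq0 n t.
  have h2 : t%:C - (a n.+1)^*%C != 0.
    by apply: pole_neq0; rewrite cImJ oppr_eq0 gt_eqF// a_gt0.
  by rewrite /b; field; rewrite h1 h2.
have splitI k : (1 <= k)%N ->
    cintegral (fun t : R => rfrac p (lows n.+1) t * (Phi a k t%:C)^*%C) =
    d * cintegral (fun t : R => Phi a n.+1 t%:C * (Phi a k t%:C)^*%C) +
    cintegral (fun t : R => rfrac q (lows n) t * (Phi a k t%:C)^*%C).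
  case: k => // k _.
  have d1 := decay_mulJ (decay_Phi n) (decay_Phi k).
  have d2 := decay_mulJ (decay_lows szq) (decay_Phi k).
  rewrite -cintegralZ// -cintegralD//; last exact: decayZ.
  by congr cintegral; apply/funext => t; rewrite pE mulrDl mulrA.
rewrite big_nat_recr//= splitI// Phi_norm Phi_orthogonal_sym// addr0.
have -> : \sum_(1 <= k < n.+1) (pi^-1)%:C *
      cintegral (fun t : R => rfrac p (lows n.+1) t * (Phi a k t%:C)^*%C) * Phi
        a k z =
    \sum_(1 <= k < n.+1) (pi^-1)%:C *
      cintegral (fun t : R => rfrac q (lows n) t * (Phi a k t%:C)^*%C) * Phi a k
        z.
  apply: eq_big_nat => -[|k]// /andP[_ kn]; rewrite splitI//.
  have szu : (size (uconst k *: upoly k) <= k.+1)%N.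
    by rewrite (leq_trans (size_scale_leq _ _))// size_upoly.
  have [r szr rE] := rfrac_lows_widen (kn : (k.+1 <= n)%N) szu.
  rewrite [X in d * X](_ : _ = 0) ?mulr0 ?add0r// -(Phi_orthogonal szr).
  congr cintegral; apply/funext => t; congr (_ * _^*%C).
  by rewrite Phi_rfrac -rE !rfrac_lows hornerZ mulrA.
have hz' k : (1 <= k <= n)%N -> z != (a k)^*%C.
  by move=> /andP[k1 kn]; apply: hz; rewrite k1 ltnW.
have qz := IH q szq hz'.
set S := \sum_(_ <= _ < _) _ in qz *.
have tauS : tau a n.+1 z = tau a n z * (z - b) by rewrite /tau big_nat_recr.
have -> : p = (d * uconst n) *: upoly n + q * ('X - b%:P).
  by rewrite -pq addrC subrK.
rewrite Phi_lpoly// hornerD hornerZ hornerM hornerXsubC -tau_lpoly qz tauS.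
have pi0 : (pi^-1)%:C * pi%:C = 1 :> R[i].
  by rewrite -rmorphM mulVf// gt_eqF// pi_gt0.
have zb : z - b != 0 by rewrite subr_eq0 hz//= leqnn.
have tz : tau a n z != 0.
  rewrite /tau prodf_seq_neq0; apply/allP => k.
  by rewrite mem_index_iota => /andP[k1 kn] /=; rewrite subr_eq0 hz'// k1.
rewrite [(pi^-1)%:C * _]mulrCA mulrA pi0 mulr1.
by field; rewrite zb tz.
Qed.

End TakenakaMalmquist.

(** * Principal part at a double pole *)

Section PrincipalPart.
Variable F : fieldType.
Implicit Types (M N G : {poly F}) (w : F).

Lemma horner_deriv_prod_XsubC w (s : seq F) :
  (forall c, c \in s -> w - c != 0) ->
  (\prod_(c <- s) ('X - c%:P))^`().[w] =
  (\prod_(c <- s) ('X - c%:P)).[w] * \sum_(c <- s) (w - c)^-1.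
Proof.
elim: s => [|c s IH] ws; first by rewrite !big_nil derivC hornerC mulr0.
rewrite !big_cons derivM derivXsubC mul1r hornerD !hornerM hornerXsubC.
rewrite IH => [|d ds]; last by apply: ws; rewrite inE ds orbT.
have wc0 : w - c != 0 by apply: ws; rewrite mem_head.
by field.
Qed.

Lemma dvdp_sqr_XsubC M w : M.[w] = 0 -> M^`().[w] = 0 ->
  ('X - w%:P) ^+ 2 %| M.
Proof.
move=> /eqP/factor_theorem[Q ->]; rewrite derivM derivXsubC mulr1.
rewrite hornerD hornerM hornerXsubC subrr mulr0 add0r => /eqP Qw.
by rewrite expr2 dvdp_mul// dvdp_XsubCl.
Qed.

(** Taylor coefficients of [N / G] at [w], so that [ppart / (X - w)^2] is the
    principal part of [N / (G (X - w)^2)] at [w]. *)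
Definition ppart0 N G w := N.[w] / G.[w].
Definition ppart1 N G w := (N^`().[w] - ppart0 N G w * G^`().[w]) / G.[w].
Definition ppart N G w : {poly F} :=
  (ppart0 N G w)%:P + ppart1 N G w *: ('X - w%:P).

Lemma size_ppart N G w : (size (ppart N G w) <= 2)%N.
Proof.
rewrite (leq_trans (size_polyD _ _))// geq_max.
rewrite (leq_trans (size_polyC_leq1 _))//=.
by rewrite (leq_trans (size_scale_leq _ _))// size_XsubC.
Qed.

Lemma ppart_dvdp N G w : G.[w] != 0 ->
  ('X - w%:P) ^+ 2 %| N - G * ppart N G w.
Proof.
move=> Gw; apply: dvdp_sqr_XsubC.
  rewrite hornerD hornerN hornerM /ppart hornerD hornerC hornerZ hornerXsubC.
  by rewrite subrr mulr0 addr0 /ppart0; field.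
rewrite derivB derivM /ppart derivD derivC derivZ derivXsubC.
rewrite hornerD hornerN hornerD !hornerM !hornerD !hornerZ !hornerC hornerXsubC.
by rewrite subrr /ppart1; field.
Qed.

End PrincipalPart.

(** * The extremal polynomial and the error *)

Section BestApproximation.
Variables (R : realType) (a : nat -> R[i]).
Hypothesis a_gt0 : forall k, (1 <= k)%N -> 0 < complex.Im (a k).
Variables (A B lambda : R) (n : nat).
Hypothesis lambda_gt0 : 0 < lambda.
Implicit Types p : {poly R[i]}.

(* R_n = numerator / (G (X - w)^2). *)
Let w : R[i] := 0 +i* lambda.
Let wc : R[i] := w^*%C.

Definition numerator : {poly R[i]} := A%:C%:P + B%:C *: 'X.

Let G : {poly R[i]} := lpoly a n * ('X - wc%:P) ^+ 2.
Let q : {poly R[i]} := ppart numerator G w.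
Let qc : {poly R[i]} := map_poly conjc q.

Lemma wc_neq_w : w - wc != 0.
Proof.
rewrite /wc /w; apply/eqP => /(congr1 (@complex.Im R)) /= h.
by have := lambda_gt0; lra.
Qed.

Lemma lpoly_w_neq0 : (lpoly a n).[w] != 0.
Proof.
rewrite horner_prod prodf_seq_neq0;
  apply/allP => c /(allP (lows_lt0 a_gt0 n)) /=.
move=> c0; rewrite hornerXsubC /w;
  apply: contraTneq c0 => /(congr1 (@complex.Im R)).
by case: c => x y /= h; rewrite -leNgt; have := lambda_gt0; lra.
Qed.

Lemma G_w_neq0 : G.[w] != 0.
Proof.
rewrite /G hornerM horner_exp hornerXsubC mulf_neq0 ?lpoly_w_neq0//.
by rewrite expf_neq0// wc_neq_w.
Qed.

Lemma map_conjc_numerator : map_poly conjc numerator = numerator.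
Proof.
rewrite /numerator rmorphD /= map_polyC /= map_polyZ /= map_polyX.
by congr (_%:P + _ *: _); exact: conj_realC.
Qed.

Let defect : {poly R[i]} := numerator - G * q - map_poly conjc (G * q).

(** At [w] the definition of [q] makes [numerator - G q] vanish twice, and the
    conjugate of [G] contains the factor [(X - w)^2]. The polynomial [defect]
    is its own conjugate, which gives the other factor. *)
Lemma defect_dvdp :
  ('X - w%:P) ^+ 2 * ('X - wc%:P) ^+ 2 %| defect.
Proof.
have dw : ('X - w%:P) ^+ 2 %| defect.
  apply: dvdp_sub; first exact: ppart_dvdp G_w_neq0.
  rewrite rmorphM /= /G rmorphM /= map_conjc_sqr_XsubC /wc conjcK.
  by rewrite dvdp_mulr// dvdp_mull.
rewrite Gauss_dvdp; last first.
  by rewrite coprimep_expl// coprimep_expr// coprimep_XsubC2// -opprB oppr_eq0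
    wc_neq_w.
rewrite dw /=.
have -> : defect = map_poly conjc defect.
  rewrite /defect rmorphB rmorphB /= map_conjcK map_conjc_numerator.
  exact: addrAC.
by rewrite /wc -map_conjc_sqr_XsubC dvdp_map.
Qed.

Definition Tpoly : {poly R[i]} := defect %/ (('X - w%:P) ^+ 2 * ('X -
  wc%:P) ^+ 2).

Lemma TpolyE : defect = Tpoly * (('X - w%:P) ^+ 2 * ('X - wc%:P) ^+ 2).
Proof. by rewrite /Tpoly divpK// defect_dvdp. Qed.

Lemma size_Tpoly : (0 < n)%N -> (size Tpoly <= n)%N.
Proof.
move=> n0; have [->|T0] := eqVneq Tpoly 0; first by rewrite size_poly0.
have szD : (size defect <= n + 4)%N.
  have szGq : (size (G * q)%R <= n + 4)%N.
    rewrite (leq_trans (size_polyMleq _ _))//.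
    have szG : (size G <= n + 3)%N.
      rewrite /G (leq_trans (size_polyMleq _ _))// size_lpoly size_exp_XsubC.
      by rewrite addSn.
    have := leq_add szG (size_ppart numerator G w); rewrite -/q.
    by move: (size G + size q)%N => m; lia.
  have szN : (size numerator <= n + 4)%N.
    rewrite (leq_trans (size_polyD _ _))// geq_max.
    rewrite (leq_trans (size_polyC_leq1 _)) ?addn4//=.
    by rewrite (leq_trans (size_scale_leq _ _))// size_polyX.
  rewrite (leq_trans (size_polyD _ _))// size_polyN geq_max size_map_poly szGq.
  by rewrite (leq_trans (size_polyD _ _))// size_polyN geq_max szGq szN.
have m2 c : ('X - c%:P : {poly R[i]}) ^+ 2 \is monic.
  by rewrite monic_exp// monicXsubC.
have : size defect = (size Tpoly + 4)%N.
  rewrite TpolyE size_Mmonic//; last by rewrite monicMr.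
  by rewrite size_monicM ?monic_neq0// !size_exp_XsubC !addnS.
by move=> szE; rewrite szE leq_add2r in szD.
Qed.

Lemma conj_rfrac_ups p (t : R) :
  (rfrac p (lows a n) t)^*%C = rfrac (map_poly conjc p) (ups a n) t.
Proof. by rewrite conj_rfrac_lows /rfrac prod_ups. Qed.

(** The two summands of the error: [Epole] carries the pole of R_n at [w], and
    [Erefl] is the Blaschke product [upoly / lpoly] times the conjugate of
    [Epole]. *)
Let Epole (t : R) := rfrac q [:: w; w] t.
Let Erefl (t : R) := rfrac (upoly a n * qc) [:: wc, wc & lows a n] t.

Definition error (t : R) : R[i] := Epole t + Erefl t.

Lemma Im_w_neq0 : complex.Im w != 0.
Proof. by rewrite /= gt_eqF. Qed.

Lemma Im_wc_neq0 : complex.Im wc != 0.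
Proof. by rewrite cImJ oppr_eq0 Im_w_neq0. Qed.

Lemma Im_wc_lt0 : complex.Im wc < 0.
Proof. by rewrite cImJ oppr_lt0. Qed.

Lemma EpoleE t : Epole t = q.[t%:C] * (t%:C - w)^-1 ^+ 2.
Proof. by rewrite /Epole /rfrac !big_cons big_nil mulr1 expr2. Qed.

Lemma EpoleJ t : (Epole t)^*%C = qc.[t%:C] * (t%:C - wc)^-1 ^+ 2.
Proof.
by rewrite /Epole conj_rfrac /rfrac /= !big_cons big_nil mulr1 expr2.
Qed.

Lemma EreflE t : Erefl t =
  (upoly a n).[t%:C] / (lpoly a n).[t%:C] * (qc.[t%:C] * (t%:C - wc)^-1 ^+ 2).
Proof.
rewrite /Erefl /rfrac !big_cons prod_lows hornerM expr2.
move: (_^-1) (_^-1) => x y; ring.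
Qed.

Lemma EreflJ t : (Erefl t)^*%C =
  (lpoly a n).[t%:C] / (upoly a n).[t%:C] * (q.[t%:C] * (t%:C - w)^-1 ^+ 2).
Proof.
have -> : Erefl t = (upoly a n).[t%:C] / (lpoly a n).[t%:C] * (Epole t)^*%C.
  by rewrite EreflE EpoleJ.
by rewrite conjcM conjcM conjc_inv conj_upoly conj_lpoly conjcK EpoleE.
Qed.

Lemma error_defect (t : R) :
  ((A + B * t) / (t ^+ 2 + lambda ^+ 2) ^+ 2)%:C - Tpoly.[t%:C] =
  (lpoly a n).[t%:C] * error t.
Proof.
have hx := pole_neq0 t Im_w_neq0; have hy := pole_neq0 t Im_wc_neq0.
have hl := lpoly_neq0 a_gt0 n t.
have eval (N L U r r' T : {poly R[i]}) (z : R[i]) :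
    N - L * ('X - wc%:P) ^+ 2 * r - U * ('X - w%:P) ^+ 2 * r' =
      T * (('X - w%:P) ^+ 2 * ('X - wc%:P) ^+ 2) ->
    N.[z] - L.[z] * (z - wc) ^+ 2 * r.[z] - U.[z] * (z - w) ^+ 2 * r'.[z] =
      T.[z] * ((z - w) ^+ 2 * (z - wc) ^+ 2).
  move=> /(congr1 (fun P => P.[z])).
  by rewrite !(hornerXsubC, hornerD, hornerN, hornerM, horner_exp).
have := TpolyE; rewrite /defect /=.
have -> : map_poly conjc (G * q) = upoly a n * ('X - w%:P) ^+ 2 * qc.
  rewrite rmorphM /= /G rmorphM /= map_conjc_lpoly map_conjc_sqr_XsubC.
  by rewrite /wc conjcK.
move=> /(eval _ _ _ _ _ _ t%:C) Teq.
have -> : ((A + B * t) / (t ^+ 2 + lambda ^+ 2) ^+ 2)%:C =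
    numerator.[t%:C] / ((t%:C - w) ^+ 2 * (t%:C - wc) ^+ 2).
  rewrite -exprMn fmorph_div /numerator hornerD hornerC hornerZ hornerX.
  rewrite rmorphXn rmorphD rmorphM; congr (_ / _ ^+ 2).
  by apply: complex_eq; rewrite !ReImE /=; ring.
rewrite /error EpoleE EreflE.
have -> : Tpoly.[t%:C] = (numerator.[t%:C] - (lpoly a n).[t%:C] * (t%:C -
  wc) ^+ 2 * q.[t%:C]
     - (upoly a n).[t%:C] * (t%:C - w) ^+ 2 * qc.[t%:C]) /
     ((t%:C - w) ^+ 2 * (t%:C - wc) ^+ 2).
  by rewrite Teq mulfK// mulf_neq0// expf_neq0.
by field; rewrite hl hx hy.
Qed.

Lemma decay_Epole : decay 1 Epole.
Proof.
apply: decay_rfrac; first by rewrite /= !gt_eqF.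
by rewrite addn1 ltnS size_ppart.
Qed.

Lemma decay_Erefl : decay 1 Erefl.
Proof.
apply: decay_rfrac; first by rewrite /= Im_wc_neq0 lows_neq0.
rewrite addn1 ltnS (leq_trans (size_polyMleq _ _))// size_upoly size_map_poly.
by have := size_ppart numerator G w; rewrite -/q /= size_lows; lia.
Qed.

Lemma decay_error : decay 1 error.
Proof. exact: decayD decay_Epole decay_Erefl. Qed.

(** Conjugating [p / lpoly] moves its poles to the upper half-plane, where they
    join those of [Epole]; in [Erefl] they are cancelled by the factor
    [upoly]. *)
Lemma error_orthogonal p : (size p <= n)%N ->
  cintegral (fun t : R => error t * (rfrac p (lows a n) t)^*%C) = 0.
Proof.
move=> szp.
have dp := decay_lows a_gt0 szp.
have d1 := decay_mulJ decay_Epole dp; have d2 := decay_mulJ decay_Erefl dp.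
under eq_fun do rewrite /error mulrDl.
have szq (r s : {poly R[i]}) : (size r <= 2)%N -> (size s <= n)%N ->
  (size (r * s)%R < n.+2)%N.
  by move=> szr szs; rewrite (leq_ltn_trans (size_polyMleq _ _))//;
    move: szr szs; lia.
rewrite cintegralD// (_ : (fun t => Epole t * _) =
  rfrac (q * map_poly conjc p) ([:: w; w] ++ ups a n)); last first.
  by apply/funext => t; rewrite conj_rfrac_ups rfracM.
rewrite cintegral_rfrac_upper ?add0r; last 2 first.
- by rewrite /= !lambda_gt0 ups_gt0.
- by rewrite /= size_ups szq ?size_ppart ?size_map_poly.
rewrite (_ : (fun t => _) =
  rfrac (qc * map_poly conjc p) [:: wc, wc & lows a n]); last first.
  apply/funext => t; rewrite EreflE conj_rfrac_lows /rfrac hornerM !big_cons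
    prod_lows.
  have hy := pole_neq0 t Im_wc_neq0.
  have hl := lpoly_neq0 a_gt0 n t; have hu := upoly_neq0 a_gt0 n t.
  by field; rewrite hl hu hy.
rewrite cintegral_rfrac_lower//.
- by rewrite /= Im_wc_lt0 lows_lt0.
- by rewrite /= size_lows szq ?size_map_poly ?size_ppart.
Qed.

(** * The norm of the error *)

Let c0 := ppart0 numerator G w.
Let c1 := ppart1 numerator G w.

(** The coefficient of [1 / ((t - w) (t - conj w))] in the partial fraction
    decomposition of [|Epole t|^2]; the other terms have double poles and
    integrate to zero. *)
Definition ppart_sqnorm : R[i] :=
  - 2 * c0 * c0^*%C / (w - wc) ^+ 2 - c0 * c1^*%C / (w - wc)
  + c1 * c0^*%C / (w - wc) + c1 * c1^*%C.

Lemma cintegral_Epole : cintegral (fun t : R => Epole t * (Epole t)^*%C) =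
  ppart_sqnorm * (pi / lambda)%:C.
Proof.
have s0 := wc_neq_w.
pose x (t : R) := (t%:C - w)^-1; pose y (t : R) := (t%:C - wc)^-1.
have dx : decay 2 (fun t => x t ^+ 2) by apply: decayX;
  exact: decay_pole Im_w_neq0.
have dy : decay 2 (fun t => y t ^+ 2) by apply: decayX;
  exact: decay_pole Im_wc_neq0.
have dxy : decay 2 (fun t => x t * y t).
  by apply: (decayM (j := 1) (k := 1)); apply: decay_pole;
    rewrite ?Im_w_neq0 ?Im_wc_neq0.
(* Repeated use of x y = (x - y) / (w - wc). *)
pose u := c0 * c0^*%C / (w - wc) ^+ 2 + c0 * c1^*%C / (w - wc).
pose v := c0 * c0^*%C / (w - wc) ^+ 2 - c1 * c0^*%C / (w - wc).
rewrite (_ : (fun t => _) = fun t => u * x t ^+ 2 + v * y t ^+ 2 +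
  ppart_sqnorm * (x t * y t)).
  rewrite !cintegralD ?cintegralZ//; try by do ?apply: decayD; exact: decayZ.
  rewrite /x /y (cintegral_pole_pow 0 Im_w_neq0) (cintegral_pole_pow 0
    Im_wc_neq0).
  by rewrite !mulr0 !add0r /wc cintegral_poisson.
apply/funext => t.
have hx := pole_neq0 t Im_w_neq0; have hy := pole_neq0 t Im_wc_neq0.
have -> : (Epole t)^*%C = (c0^*%C + c1^*%C * (t%:C - wc)) * (t%:C - wc)^-1 ^+ 2.
  rewrite EpoleJ; congr (_ * _); rewrite /qc /q /ppart -/c0 -/c1.
  rewrite rmorphD /= map_polyC /= map_polyZ /= rmorphB /= map_polyX map_polyC
    /=.
  by rewrite hornerD hornerZ hornerC hornerXsubC.
rewrite EpoleE /q /ppart -/c0 -/c1 hornerD hornerZ hornerC hornerXsubC.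
rewrite /ppart_sqnorm /u /v /x /y; field.
by rewrite hx hy s0.
Qed.

(** [Epole] and [Erefl] are orthogonal, because the product of [Epole] with the
    conjugate of [Erefl] only has poles in the upper half-plane, and they have
    the same modulus. *)
Lemma error_norm : cintegral (fun t : R => error t * (error t)^*%C) =
  2 * (ppart_sqnorm * (pi / lambda)%:C).
Proof.
have d11 := decay_mulJ decay_Epole decay_Epole.
have d12 := decay_mulJ decay_Epole decay_Erefl.
have d21 : decay 2 (fun t => (Epole t * (Erefl t)^*%C)^*%C) by exact: decayJ.
have szq2 := size_ppart numerator G w.
have i12 : cintegral (fun t => Epole t * (Erefl t)^*%C) = 0.
  rewrite (_ : (fun t => _) =
      rfrac (q * q * lpoly a n) ([:: w; w; w; w] ++ ups a n)).
    rewrite cintegral_rfrac_upper//; first by rewrite /= !lambda_gt0 ups_gt0.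
    rewrite size_cat size_ups (leq_ltn_trans (size_polyMleq _ _))//.
    have := size_polyMleq q q; rewrite size_lpoly /=.
    by move: (size (q * q)%R) szq2; rewrite -/q; move: (size q); lia.
  apply/funext => t; rewrite EreflJ EpoleE /rfrac big_cat !big_cons big_nil
    prod_ups !hornerM /=.
  have hx := pole_neq0 t Im_w_neq0.
  have hu := upoly_neq0 a_gt0 n t.
  by field; rewrite hu hx.
rewrite (_ : (fun t => _) = fun t =>
    2 * (Epole t * (Epole t)^*%C) + (Epole t * (Erefl t)^*%C +
      (Epole t * (Erefl t)^*%C)^*%C)).
  rewrite cintegralD ?cintegralZ//; first last.
  - exact: decayD.
  - exact: decayZ.
  by rewrite cintegralD// cintegralJ// i12 conjc0 !addr0 cintegral_Epole.
apply/funext => t; rewrite /error conjcD [(Epole t * _)^*%C]conjcM conjcK.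
have -> : (Erefl t)^*%C = (lpoly a n).[t%:C] / (upoly a n).[t%:C] * Epole t.
  by rewrite EreflJ EpoleE.
have -> : (Erefl t) = (upoly a n).[t%:C] / (lpoly a n).[t%:C] * (Epole t)^*%C.
  by rewrite EreflE EpoleJ.
have hl := lpoly_neq0 a_gt0 n t; have hu := upoly_neq0 a_gt0 n t.
by move: (Epole t) (Epole t)^*%C => z z'; field; rewrite hl hu.
Qed.

(** * The value of the minimum *)

(** The logarithmic derivative of tau_n at [w]. Up to the common factor
    [1 / G.[w]], the coefficients of [q] are [X0] and [X1]. *)
Let L : R[i] := \sum_(c <- lows a n) (w - c)^-1.
Let X0 : R[i] := A%:C + B%:C * w.
Let X1 : R[i] := B%:C - X0 * (L + 2 / (w - wc)).

Lemma w_sub_lows_neq0 c : c \in lows a n -> w - c != 0.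
Proof.
move=> /(allP (lows_lt0 a_gt0 n)) lt0; apply: contraTneq lt0.
move=> /(congr1 (@complex.Im R)); rewrite /w; case: c => x y /= h.
by rewrite -leNgt; have := lambda_gt0; lra.
Qed.

Lemma ppart_sqnormE : ppart_sqnorm =
  (- 2 * X0 * X0^*%C / (w - wc) ^+ 2 - X0 * X1^*%C / (w - wc)
   + X1 * X0^*%C / (w - wc) + X1 * X1^*%C) /
  (sqnorm ((lpoly a n).[w] * (w - wc) ^+ 2))%:C.
Proof.
set T := (lpoly a n).[w].
have T0 : T != 0 := lpoly_w_neq0.
have s0 := wc_neq_w.
have Gw : G.[w] = T * (w - wc) ^+ 2.
  by rewrite /G hornerM horner_exp hornerXsubC.
have G'w : G^`().[w] = T * L * (w - wc) ^+ 2 + T * (2 * (w - wc)).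
  rewrite /G expr2 !derivM derivXsubC mul1r mulr1.
  rewrite !(hornerXsubC, hornerD, hornerM).
  by rewrite (horner_deriv_prod_XsubC w_sub_lows_neq0) -/L -/(lpoly a n) -/T;
    ring.
have Nw : numerator.[w] = X0 by rewrite /numerator hornerD hornerC hornerZ
  hornerX.
have N'w : numerator^`().[w] = B%:C.
  by rewrite /numerator derivD derivC derivZ derivX hornerD hornerZ !hornerC
    mulr1 add0r.
have c0E : c0 = X0 / (T * (w - wc) ^+ 2) by rewrite /c0 /ppart0 Gw Nw.
have c1E : c1 = X1 / (T * (w - wc) ^+ 2).
  rewrite /c1 /ppart1 /ppart0 Gw G'w Nw N'w /X1.
  by field; rewrite T0 s0.
rewrite /ppart_sqnorm c0E c1E -mulJ_sqnorm.
have conjcV x : (x^-1)^*%C = (x^*%C)^-1 :> R[i] by exact: conjc_inv.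
have g0 : T * (w - wc) ^+ 2 != 0 by rewrite mulf_neq0// expf_neq0.
have gc0 : (T * (w - wc) ^+ 2)^*%C != 0 by rewrite conjc_eq0.
move: (T * (w - wc) ^+ 2) g0 gc0 => g g0 gc0.
rewrite !conjcM !conjcV.
by field; rewrite g0 gc0 s0.
Qed.

Lemma error_norm_value (An Bn mu : R) :
  L = - An -i* Bn -> sqnorm (lpoly a n).[w] = mu -> mu != 0 ->
  2 * (ppart_sqnorm * (pi / lambda)%:C) =
  ((16 * lambda ^+ 4)^-1 * (2 * pi / (lambda * mu) *
      ((A / lambda + lambda * B * An) ^+ 2
       + (3 * A ^+ 2 + lambda ^+ 2 * B ^+ 2) / (2 * lambda ^+ 2)
       + (3 * A ^+ 2 + lambda ^+ 2 * B ^+ 2) / lambda * Bn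
       + A ^+ 2 * An ^+ 2
       + (A ^+ 2 + lambda ^+ 2 * B ^+ 2) * Bn ^+ 2)))%:C.
Proof.
move=> LE muE mu0; have l0 : lambda != 0 by rewrite gt_eqF.
rewrite ppart_sqnormE /X1 LE sqnormM muE.
have sE : w - wc = 0 +i* (2 * lambda).
  by apply: complex_eq; rewrite /wc /w /=; ring.
have sV : (w - wc)^-1 = 0 +i* (- (2 * lambda)^-1).
  by rewrite sE; apply: complex_eq; rewrite !ReImE /=; field.
have -> : sqnorm ((w - wc) ^+ 2) = 16 * lambda ^+ 4.
  by rewrite sE expr2 sqnormM /sqnorm /=; ring.
have -> : X0 = A +i* (B * lambda).
  by apply: complex_eq; rewrite /X0 /w !ReImE /=; ring.
have -> : B%:C - (A +i* (B * lambda)) * ((- An -i* Bn) + 2 / (w - wc)) =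
    (B + A * An - B * lambda * (Bn + lambda^-1)) +i*
    (A * (Bn + lambda^-1) + B * lambda * An).
  by rewrite sV; apply: complex_eq; rewrite !ReImE /=; field.
rewrite expr2 invfM sV.
have real_form (x y x' y' : R) :
    - 2 * (x +i* y) * (x +i* y)^*%C *
      ((0 +i* (- (2 * lambda)^-1)) * (0 +i* (- (2 * lambda)^-1)))
    - (x +i* y) * (x' +i* y')^*%C * (0 +i* (- (2 * lambda)^-1))
    + (x' +i* y') * (x +i* y)^*%C * (0 +i* (- (2 * lambda)^-1))
    + (x' +i* y') * (x' +i* y')^*%C =
  ((x ^+ 2 + y ^+ 2) / (2 * lambda ^+ 2) + (y' * x - x' * y) / lambda
    + (x' ^+ 2 + y' ^+ 2))%:C.
  by apply: complex_eq; rewrite !ReImE /=; field.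
rewrite real_form -fmorphV -!rmorphM.
rewrite -[2 in LHS](rmorph_nat (real_complex R)) -rmorphM.
congr (_%:C).
by field; rewrite l0 mu0.
Qed.

(** Pythagoras for the decomposition of [R_n - p / tau_n] into [error] and
    [(T - p) / tau_n]. *)
Lemma Ffun_split (rho0 : R[i]) p : (0 < n)%N -> rho0 != 0 -> (size p <= n)%N ->
  Ffun A B lambda a rho0 n p =
  ((cmod rho0 ^+ 2)^-1 *
   complex.Re (cintegral (fun t : R => error t * (error t)^*%C) +
     cintegral (fun t : R => rfrac (Tpoly - p) (lows a n) t *
       (rfrac (Tpoly - p) (lows a n) t)^*%C)))%:E.
Proof.
move=> n0 rho00 szp.
have szTp : (size (Tpoly - p)%R <= n)%N.
  by rewrite (leq_trans (size_polyD _ _))// size_polyN geq_max size_Tpoly.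
have dTp := decay_lows a_gt0 szTp.
rewrite -pythagoras//; last 2 first.
- exact: decay_error.
- exact: error_orthogonal.
rewrite -sqnorm_integral; last exact: decayD decay_error dTp.
rewrite /Ffun; apply: eq_integral => t _; congr (_%:E).
have hl := lpoly_neq0 a_gt0 n t.
have -> : ((A + B * t) / (t ^+ 2 + lambda ^+ 2) ^+ 2)%:C - p.[t%:C] =
    (lpoly a n).[t%:C] * (error t + rfrac (Tpoly - p) (lows a n) t).
  rewrite mulrDr -error_defect rfrac_lows hornerD hornerN.
  by move: (_%:C) => v; field.
rewrite !cmod_sqnorm rho_upoly !sqnormM -(sqnormJ (upoly a n).[t%:C]).
rewrite conj_upoly.
have : sqnorm (lpoly a n).[t%:C] != 0 by rewrite sqnorm_eq0.
have : sqnorm rho0 != 0 by rewrite sqnorm_eq0.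
move: (sqnorm _) (sqnorm _) (sqnorm _) => x y z hx hy.
by field; rewrite hx hy.
Qed.

(** As [error] is orthogonal to every [Phi_k] with [k <= n], the functions R_n
    and [T / tau_n] have the same Fourier coefficients, and the latter is the
    sum of its expansion. *)
Lemma Tpoly_is_Tpoly : (0 < n)%N -> is_Tpoly A B lambda a n Tpoly.
Proof.
move=> n0 z hz.
have hz' k : (1 <= k <= n)%N -> z != (a k)^*%C by exact: hz.
rewrite (Takenaka_expansion a_gt0 (size_Tpoly n0) hz') /fourier_sum.
congr (tau a n z * _); apply: eq_big_nat => -[//|k] /andP[_ kn].
rewrite /fourier_coef; congr (_ * _ * Phi a k.+1 z).
rewrite [RHS](_ : _ = cintegral (fun t : R =>
  Rfun A B lambda a n t%:C * (Phi a k.+1 t%:C)^*%C)); last by [].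
have dT := decay_lows a_gt0 (size_Tpoly n0).
have dP := decay_Phi a_gt0 k.
transitivity (cintegral (fun t : R => error t * (Phi a k.+1 t%:C)^*%C +
    rfrac Tpoly (lows a n) t * (Phi a k.+1 t%:C)^*%C)).
  rewrite cintegralD; [|exact: decay_mulJ decay_error dP|exact: decay_mulJ].
  have szu : (size (uconst a k *: upoly a k) <= k.+1)%N.
    by rewrite (leq_trans (size_scale_leq _ _))// size_upoly.
  have [r szr rE] := rfrac_lows_widen a_gt0 (kn : (k.+1 <= n)%N) szu.
  rewrite [X in _ = X + _](_ : _ = 0) ?add0r// -(error_orthogonal szr).
  congr cintegral; apply/funext => t; congr (_ * _^*%C).
  by rewrite Phi_rfrac// -rE !rfrac_lows hornerZ mulrA.
congr cintegral; apply/funext => t; rewrite -mulrDl; congr (_ * _).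
have hl := lpoly_neq0 a_gt0 n t.
have tl0 : t%:C ^+ 2 + lambda%:C ^+ 2 != 0 :> R[i].
  rewrite -!rmorphXn -rmorphD fmorph_eq0 gt_eqF// ltr_wpDl ?sqr_ge0//.
  by rewrite exprn_gt0.
apply: (mulfI hl); rewrite mulrDr -error_defect rfrac_lows.
have -> : ((A + B * t) / (t ^+ 2 + lambda ^+ 2) ^+ 2)%:C =
    (A%:C + B%:C * t%:C) / (t%:C ^+ 2 + lambda%:C ^+ 2) ^+ 2 :> R[i].
  by rewrite fmorph_div rmorphXn !rmorphD !rmorphXn rmorphM.
rewrite /Rfun tau_lpoly; move: Tpoly.[_] => v.
by field; rewrite tl0 hl.
Qed.

End BestApproximation.

(* The factor 1 / (16 lambda^4 |rho0|^2) is a correction: the closed form is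
   printed without it, and is then false.  The functional is homogeneous of
   degree -2 in rho0, and under (A, lambda, a_k) -> (s A, s lambda, s a_k) the
   two sides scale consistently only with the factor lambda^-4. *)
Theorem mainTheorem1 (R : realType) (n : nat) (A B lambda : R)
    (alpha beta : nat -> R) (rho0 : R[i])
    (n_gt0 : (1 <= n)%N) (lambda_gt0 : 0 < lambda)
    (beta_gt0 : forall k : nat, (1 <= k)%N -> 0 < beta k)
    (rho0_neq0 : rho0 != 0) :
  let a : nat -> R[i] := fun k => alpha k +i* beta k in
  let F : {poly R[i]} -> \bar R := Ffun A B lambda a rho0 n in
  let mu_n := mu_ alpha beta lambda n in
  let An := calA alpha beta lambda n in
  let Bn := calB alpha beta lambda n in
  (exists T : {poly R[i]},
     [/\ is_Tpoly A B lambda a n T,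
         (size T <= n)%N
       & forall p : {poly R[i]}, (size p <= n)%N -> (F T <= F p)%E])
  /\
  ereal_inf [set F p | p in [set p : {poly R[i]} | (size p <= n)%N]] =
    ((16 * lambda ^+ 4 * cmod rho0 ^+ 2)^-1 *
     (2 * pi / (lambda * mu_n) *
      ((A / lambda + lambda * B * An) ^+ 2
       + (3 * A ^+ 2 + lambda ^+ 2 * B ^+ 2) / (2 * lambda ^+ 2)
       + (3 * A ^+ 2 + lambda ^+ 2 * B ^+ 2) / lambda * Bn
       + A ^+ 2 * An ^+ 2
       + (A ^+ 2 + lambda ^+ 2 * B ^+ 2) * Bn ^+ 2)))%:E.
Proof.
move=> a F mu_n An Bn.
have a_gt0 k : (1 <= k)%N -> 0 < complex.Im (a k) by exact: beta_gt0.
pose T := Tpoly a A B lambda n.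
have szT : (size T <= n)%N by exact: size_Tpoly.
pose value := (cmod rho0 ^+ 2)^-1 * complex.Re (cintegral (fun t : R =>
  error a A B lambda n t * (error a A B lambda n t)^*%C)).
have FT : F T = value%:E.
  rewrite /F Ffun_split// -/T subrr; congr (_ * _)%:E.
  rewrite cReD; rewrite [X in _ + X](_ : _ = 0) ?addr0//.
  rewrite (_ : (fun t => _) = rfrac 0 [:: 0 +i* 1]); last first.
    by apply/funext => t; rewrite !rfrac0 mul0r.
  by rewrite cintegral_rfrac_upper ?size_poly0//= ltr01.
have FTp (p : {poly R[i]}) : (size p <= n)%N -> (F T <= F p)%E.
  move=> szp; rewrite FT /F Ffun_split// lee_fin /value ler_wpM2l//.
    by rewrite invr_ge0 sqr_ge0.
  by rewrite cReD lerDl Re_cintegral_sqnorm_ge0.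
split; first by exists T; split => //; exact: Tpoly_is_Tpoly.
rewrite (_ : ereal_inf _ = F T); last first.
  apply/eqP; rewrite eq_le; apply/andP; split.
    by apply: ereal_inf_lbound; exists T.
  by apply: le_ereal_inf_tmp => _ [p szp <-]; exact: FTp.
rewrite FT /value (error_norm a_gt0)//.
have ak k : (1 <= k <= n)%N -> alpha k ^+ 2 + (beta k + lambda) ^+ 2 != 0.
  move=> /andP[k1 _]; rewrite gt_eqF// ltr_wpDl ?sqr_ge0// exprn_gt0//.
  by rewrite addr_gt0// beta_gt0.
have mu0 : mu_n != 0.
  rewrite /mu_n /mu_ prodf_seq_neq0; apply/allP => k.
  by rewrite mem_index_iota ltnS => /ak.
rewrite (@error_norm_value _ _ a_gt0 A B lambda n lambda_gt0 An Bn mu_n)//.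
- by congr (_%:E); rewrite mulrA -invfM [cmod _ ^+ 2 * _]mulrC.
- rewrite /lows /ups !big_map; apply: complex_eq => /=.
    rewrite (big_morph _ (@cReD R) erefl) /An /calA -sumrN.
    apply: eq_big_nat => k /ak k0; rewrite cReV /= sub0r opprK sqrrN mulNr.
    by rewrite [lambda + _]addrC.
  rewrite (big_morph _ (@cImD R) erefl) /Bn /calB -sumrN.
  apply: eq_big_nat => k /ak k0; rewrite cImV /= sub0r opprK sqrrN mulNr.
  by rewrite [lambda + _]addrC.
- rewrite horner_prod /mu_n /mu_ /lows /ups !big_map.
  rewrite (big_morph _ (@sqnormM R) (id1 := 1)); last first.
    by rewrite /sqnorm /= expr1n expr0n addr0.
  apply: eq_big_nat => k _; rewrite hornerXsubC /sqnorm /= sub0r sqrrN opprK.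
  by rewrite [lambda + _]addrC.
Qed.
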